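(* Let $(R,\mathfrak{m},k)$ be any Cohen-Macaulay local ring. Then the pair $(\mathrm{CohCM}(R),\mathrm{CohCM}(R)^{\perp})$ is a perfect hereditary closed cotorsion pair in the category of all $R$-modules.
   Context: Cohen-Macaulay local rings are commutative and Noetherian. $\mathrm{CohCM}(R)$ is the class of all $R$-modules $M$ with $\mathrm{Ext}_R^i(k,M)=0$ for all $i<\dim R$. For a class $\mathcal{A}$ of $R$-modules, $\mathcal{A}^{\perp}=\{M:\mathrm{Ext}_R^1(A,M)=0\ \forall A\in\mathcal{A}\}$ and ${}^{\perp}\mathcal{A}=\{M:\mathrm{Ext}_R^1(M,A)=0\ \forall A\in\mathcal{A}\}$. A pair $(\mathcal{F},\mathcal{G})$ is a cotorsion pair if $\mathcal{F}^{\perp}=\mathcal{G}$ and ${}^{\perp}\mathcal{G}=\mathcal{F}$. It is hereditary if $\mathcal{F}$ is closed under kernels of epimorphisms (between modules in $\mathcal F$), perfect if $\mathcal{F}$ is covering and $\mathcal{G}$ is enveloping, and closed if $\mathcal{F}$ is closed under direct limits. A class $\mathcal{G}$ is enveloping if every module $M$ has a map $\phi:M\to G$ with $G\in\mathcal{G}$ such that every map $M\to G'$ with $G'\in\mathcal{G}$ factors through $\phi$, and every endomorphism $\alpha$ of $G$ with $\alpha\phi=\phi$ is an automorphism; covering is the dual notion. *)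

(* Defs.v *)
From HB Require Import structures.
From mathcomp Require Import all_boot all_algebra.
From mathcomp Require Import freeg.

Set Implicit Arguments.
Unset Strict Implicit.
Unset Printing Implicit Defensive.

Import GRing.Theory.
Local Open Scope ring_scope.

(* MathComp's idealr_closed requires 1 \notin I, so the ideals quantified over
   below are proper. *)
Section LocalRings.
Variable R : comNzRingType.
Implicit Types (I m : {pred R}) (s : seq R).

Definition ideal_span s (x : R) : Prop :=
  exists c : nat -> R, x = \sum_(i < size s) c i * s`_i.

Definition noetherian : Prop :=
  forall I, idealr_closed I -> exists s, forall x, x \in I <-> ideal_span s x.

Definition maximal_ideal I : Prop :=
  idealr_closed I /\
  forall J : {pred R}, idealr_closed J -> {subset I <= J} -> J =i I.

Definition prime_ideal I : Prop := idealr_closed I /\ prime_idealr_closed I.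

(* (R, m, k) is a local ring: pi presents the field k as R / m. *)
Definition local_ring m (k : fieldType) (pi : {rmorphism R -> k}) : Prop :=
  [/\ maximal_ideal m,
      forall I, maximal_ideal I -> I =i m,
      forall y, exists x, pi x = y
    & forall x, (x \in m) = (pi x == 0)].

Definition strict_subset (I J : {pred R}) : Prop :=
  {subset I <= J} /\ exists2 x, x \in J & x \notin I.

Definition prime_chain (n : nat) (p : nat -> {pred R}) : Prop :=
  (forall i, (i <= n)%N -> prime_ideal (p i)) /\
  (forall i, (i < n)%N -> strict_subset (p i) (p i.+1)).

Definition has_krull_dim (d : nat) : Prop :=
  (exists p, prime_chain d p) /\
  (forall n p, prime_chain n p -> (n <= d)%N).

Definition regular_sequence s : Prop :=
  ~ ideal_span s 1 /\
  forall i, (i < size s)%N ->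
    forall a, ideal_span (take i s) (a * s`_i) -> ideal_span (take i s) a.

Definition has_depth m (d : nat) : Prop :=
  (exists s, [/\ regular_sequence s, {subset s <= m} & size s = d]) /\
  (forall s, regular_sequence s -> {subset s <= m} -> (size s <= d)%N).

Definition cohen_macaulay_local m (k : fieldType) (pi : {rmorphism R -> k}) :=
  [/\ noetherian, local_ring m pi &
      exists2 d, has_krull_dim d & has_depth m d].

End LocalRings.

Definition residue_module (R : comNzRingType) (k : fieldType)
  (pi : {rmorphism R -> k}) : Type := k.

Section ResidueModule.
Variables (R : comNzRingType) (k : fieldType) (pi : {rmorphism R -> k}).

HB.instance Definition _ := GRing.Zmodule.on (residue_module pi).

Definition residue_scale (a : R) (v : residue_module pi) : residue_module pi :=
  pi a * (v : k).

Fact residue_scaleA a b v :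
  residue_scale a (residue_scale b v) = residue_scale (a * b) v.
Proof. by rewrite /residue_scale mulrA rmorphM. Qed.

Fact residue_scale1 : left_id 1 residue_scale.
Proof. by move=> v; rewrite /residue_scale rmorph1 mul1r. Qed.

Fact residue_scaleDr : right_distributive residue_scale +%R.
Proof. by move=> a u v; rewrite /residue_scale mulrDr. Qed.

Fact residue_scaleDl v : {morph residue_scale^~ v : a b / a + b}.
Proof. by move=> a b; rewrite /residue_scale rmorphD mulrDl. Qed.

HB.instance Definition _ := GRing.Zmodule_isLmodule.Build R (residue_module pi)
  residue_scaleA residue_scale1 residue_scaleDr residue_scaleDl.

End ResidueModule.

Section Ext.
Variable R : comNzRingType.

Definition projective (P : lmodType R) : Prop :=
  forall (A B : lmodType R) (p : {linear A -> B}) (f : {linear P -> B}),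
    (forall b, exists a, p a = b) ->
    exists g : {linear P -> A}, forall x, p (g x) = f x.

Record projective_resolution (N : lmodType R) := ProjectiveResolution {
  res_term : nat -> lmodType R;
  res_d : forall n, {linear res_term n.+1 -> res_term n};
  res_aug : {linear res_term 0 -> N};
  res_projective : forall n, projective (res_term n);
  res_aug_surj : forall y, exists x, res_aug x = y;
  res_exact0 : forall x, res_aug x = 0 <-> exists y, x = res_d 0 y;
  res_exact : forall n x, res_d n x = 0 <-> exists y, x = res_d n.+1 y
}.

Section HomComplex.
Variables (N M : lmodType R) (P : projective_resolution N).

Definition cocycle (i : nat) (f : {linear res_term P i -> M}) : Prop :=
  forall y, f (res_d P i y) = 0.

Definition coboundary (i : nat) : {linear res_term P i -> M} -> Prop :=
  match i with
  | 0 => fun f => forall x, f x = 0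
  | j.+1 => fun f =>
      exists g : {linear res_term P j -> M}, forall x, f x = g (res_d P j x)
  end.

End HomComplex.

(* Ext^i_R(N, M) = H^i(Hom_R(P, M)) for P a projective resolution of N; it does
   not depend on P, and P exists by projective_resolution_exists below. *)
Definition Ext_eq0 (i : nat) (N M : lmodType R) : Prop :=
  forall (P : projective_resolution N) (f : {linear res_term P i -> M}),
    cocycle f -> coboundary f.

End Ext.

Section FreeResolution.
Variable R : comNzRingType.

Section Lift.
Variables (K : choiceType) (M : lmodType R) (f : K -> M).

Fact fglift_sumE (D : {freeg K / R}) :
  fglift f D = \sum_(x <- dom D) coeff x D *: f x.
Proof.
have addf := @lift_is_additive R K M f.
have fgM0 : fglift f 0 = 0 by rewrite -[0 in LHS](subrr 0) addf subrr.
have fgMD : {morph fglift f : x y / x + y}.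
  have fgMN y : fglift f (- y) = - fglift f y by rewrite -[- y]sub0r addf fgM0 sub0r.
  by move=> x y; rewrite -[y in LHS]opprK addf fgMN opprK.
rewrite -[in LHS](freeg_sumE D) (big_morph _ fgMD fgM0).
by apply: eq_bigr => x _; rewrite liftU.
Qed.

Fact fglift_linear : linear (fglift f : {freeg K / R} -> M).
Proof.
have addf := @lift_is_additive R K M f.
have wide (s : seq K) (D : {freeg K / R}) : uniq s -> {subset dom D <= s} ->
    fglift f D = \sum_(x <- s) coeff x D *: f x.
  move=> us sub; rewrite fglift_sumE [RHS](bigID (mem (dom D))) /=.
  rewrite [X in _ + X]big1 ?addr0 => [|x /coeff_outdom ->]; last by rewrite scale0r.
  rewrite -[RHS]big_filter; apply: perm_big; apply: uniq_perm.
  - exact: uniq_dom.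
  - exact: filter_uniq.
  by move=> x; rewrite mem_filter; case xD: (x \in dom D) => //=; rewrite sub.
move=> a u v; set s := undup (dom u ++ dom v ++ dom (a *: u + v)).
have us : uniq s := undup_uniq _.
rewrite !(wide s) // => [|x xD|x xD|x xD]; do ?by rewrite mem_undup !mem_cat xD ?orbT.
rewrite scaler_sumr -big_split; apply: eq_bigr => x _ /=.
by rewrite coeffD coeffZ scalerDl scalerA.
Qed.

HB.instance Definition _ :=
  GRing.isLinear.Build R {freeg K / R} M *:%R (fglift f) fglift_linear.

End Lift.

Fact freeg_projective (K : choiceType) : projective {freeg K / R}.
Proof.
move=> A B p f p_surj.
have pf x : exists a, p a == f << x >>.
  by have [a pa] := p_surj (f << x >>); exists a; apply/eqP.
exists (fglift (fun x => xchoose (pf x))) => D.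
rewrite /= fglift_sumE linear_sum -[D in RHS]freeg_sumE linear_sum.
apply: eq_bigr => x _; rewrite linearZ (eqP (xchooseP (pf x))) -linearZ /=.
congr (f _); apply/eqP/freeg_eqP => y.
by rewrite coeffZ !coeffU mul1r.
Qed.

Section Kernel.
Variables (U V : lmodType R) (f : {linear U -> V}).

Definition lin_ker : {pred U} := [pred x | f x == 0].

Fact lin_ker_submod : submod_closed lin_ker.
Proof.
split=> [|a u v]; rewrite !inE ?linear0 // => /eqP fu /eqP fv.
by rewrite linearP fu fv scaler0 addr0.
Qed.
HB.instance Definition _ := GRing.isSubmodClosed.Build R U lin_ker lin_ker_submod.

Record ker_type := KerType { ker_val : U; _ : ker_val \in lin_ker }.
HB.instance Definition _ := [isSub for ker_val].
HB.instance Definition _ := [Choice of ker_type by <:].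
HB.instance Definition _ := [SubChoice_isSubLmodule of ker_type by <:].

End Kernel.

Lemma projective_resolution_exists (N : lmodType R) :
  inhabited (projective_resolution N).
Proof.
pose free (M : lmodType R) : lmodType R := {freeg M / R}.
pose aug M : {linear free M -> M} := fglift (@id M).
have aug_surj M y : exists x, aug M x = y.
  by exists << y >>; rewrite /aug /= liftU scale1r.
pose syz := fix syz n : lmodType R :=
  if n is n'.+1 then ker_type (aug (syz n')) : lmodType R else N.
pose d n : {linear free (syz n.+1) -> free (syz n)} :=
  (val : {linear ker_type (aug (syz n)) -> _}) \o aug (syz n.+1).
have exact_aug n x : aug (syz n) x = 0 <-> exists y, x = d n y.
  split=> [x0|[y ->]]; last by apply/eqP; exact: (valP (aug (syz n.+1) y)).
  have xker : x \in lin_ker (aug (syz n)) by rewrite inE x0.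
  have [y yx] := aug_surj (syz n.+1) (KerType xker).
  by exists y; rewrite /d /= yx.
split; exists (fun n => free (syz n)) d (aug N) => //.
- by move=> n; apply: freeg_projective.
- exact: (exact_aug 0).
move=> n x; split=> [dx0|/exact_aug e]; last by rewrite /d /= e.
by apply/exact_aug/val_inj.
Qed.

End FreeResolution.

Section Classes.
Variable R : comNzRingType.
Implicit Types F G : lmodType R -> Prop.

Definition right_perp F : lmodType R -> Prop :=
  fun M => forall A, F A -> Ext_eq0 1 A M.

Definition left_perp G : lmodType R -> Prop :=
  fun M => forall A, G A -> Ext_eq0 1 M A.

Definition cotorsion_pair F G : Prop :=
  (forall M, right_perp F M <-> G M) /\ (forall M, left_perp G M <-> F M).

(* The submodule ker g is given as an injection f with image ker g. *)
Definition hereditary F : Prop :=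
  forall (A B C : lmodType R) (f : {linear A -> B}) (g : {linear B -> C}),
    injective f -> (forall y, g y = 0 <-> exists x, y = f x) ->
    (forall z, exists y, g y = z) ->
    F B -> F C -> F A.

Definition enveloping G : Prop :=
  forall M : lmodType R, exists (E : lmodType R) (phi : {linear M -> E}),
    [/\ G E,
        forall (E' : lmodType R) (psi : {linear M -> E'}), G E' ->
          exists h : {linear E -> E'}, forall x, h (phi x) = psi x
      & forall alpha : {linear E -> E},
          (forall x, alpha (phi x) = phi x) -> bijective alpha].

Definition covering F : Prop :=
  forall M : lmodType R, exists (C : lmodType R) (phi : {linear C -> M}),
    [/\ F C,
        forall (C' : lmodType R) (psi : {linear C' -> M}), F C' ->
          exists h : {linear C' -> C}, forall x, phi (h x) = psi x
      & forall alpha : {linear C -> C},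
          (forall x, phi (alpha x) = phi x) -> bijective alpha].

Definition perfect F G : Prop := covering F /\ enveloping G.

(* The index preorder is small: its universe is that of the carriers of
   modules. *)
Record directed_system := DirectedSystem {
  ds_index : Type@{mathcomp.algebra.ssralg.GRing.Lmodule.axioms_.u0};
  ds_le : ds_index -> ds_index -> Prop;
  ds_obj : ds_index -> lmodType R;
  ds_map : forall i j, ds_le i j -> {linear ds_obj i -> ds_obj j};
  ds_inhab : inhabited ds_index;
  ds_refl : forall i, ds_le i i;
  ds_trans : forall i j k, ds_le i j -> ds_le j k -> ds_le i k;
  ds_directed : forall i j, exists2 k, ds_le i k & ds_le j k;
  ds_map_id : forall i (ii : ds_le i i) x, ds_map ii x = x;
  ds_map_comp : forall i j k (ij : ds_le i j) (jk : ds_le j k) (ik : ds_le i k) x,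
    ds_map jk (ds_map ij x) = ds_map ik x
}.

Definition cocone (S : directed_system) (L : lmodType R)
    (iota : forall i : ds_index S, {linear ds_obj i -> L}) : Prop :=
  forall i j (ij : ds_le i j) x, iota j (ds_map ij x) = iota i x.

Definition is_direct_limit (S : directed_system) (L : lmodType R)
    (iota : forall i : ds_index S, {linear ds_obj i -> L}) : Prop :=
  cocone iota /\
  forall (T : lmodType R) (tau : forall i : ds_index S, {linear ds_obj i -> T}),
    cocone tau ->
    (exists h : {linear L -> T}, forall i x, h (iota i x) = tau i x) /\
    (forall h h' : {linear L -> T},
       (forall i x, h (iota i x) = tau i x) ->
       (forall i x, h' (iota i x) = tau i x) -> h =1 h').

Definition closed_direct_limits F : Prop :=
  forall (S : directed_system) (L : lmodType R)
    (iota : forall i : ds_index S, {linear ds_obj i -> L}),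
    is_direct_limit iota -> (forall i : ds_index S, F (ds_obj i)) -> F L.

Definition CohCM (k : fieldType) (pi : {rmorphism R -> k}) : lmodType R -> Prop :=
  fun M => forall d, has_krull_dim R d ->
    forall i, (i < d)%N -> Ext_eq0 i (residue_module pi) M.

End Classes.

(* Main.v *)
Require Import Defs.
From HB Require Import structures.
From mathcomp Require Import all_boot all_algebra.
From mathcomp Require Import freeg boolp classical_sets.

(* Write F_j for the class of modules M with Ext^i(k, M) = 0 for all i < j, and
   suppose R has depth at least d. For j <= d every module has a special
   F_j-precover and a special F_j-preenvelope, by induction on j. Given a special
   F_j-preenvelope M -> N, let J -> N be a precover by injective modules without
   k-socle; it exists because R is Noetherian. If A is in F_{j+1}, its injective
   hull E has no k-socle and E/A is in F_j, so every map A -> N extends to E and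
   then lifts to J. For A = R this shows that J -> N is onto, and in general that
   its kernel is Ext^1-orthogonal to F_{j+1}; as N/M is in F_j, the preimage of M
   in J is in F_{j+1}, hence a special precover of M. Salce's lemma turns
   precovers back into preenvelopes. Finally F_d is closed under direct limits,
   since syzygies of k are finitely presented, and by Enochs' argument direct
   limits make the approximations minimal. *)

Set Implicit Arguments.
Unset Strict Implicit.
Unset Printing Implicit Defensive.

Import GRing.Theory.
Local Open Scope ring_scope.

(** Cohen-Macaulayness enters once: a regular sequence of length dim R puts R itself in F_d, and the
    step from j to j+1 needs R in F_{j+1}. An injective module J without k-socle lies in every F_j,
    because Hom(k, J) = 0 and the higher Ext groups into J vanish; this is why passing from C in F_j
    to the kernel of J -> C gains one degree. Two questions of size shape the rest. The precover J
    -> N has to receive all torsion-free injective modules from a single sum. It suffices to sum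
    hulls E(R/I): every nonzero element of a complement of an injective submodule spans a cyclic
    module whose hull splits off inside that complement, and Noetherianity lets such submodules grow
    by unions. Enochs' argument needs chains of endomorphisms too long to exist; instead of ordinals
    they are indexed by subsets of a type, and Cantor's diagonal argument supplies an index that is
    still free. Covers and envelopes share this argument through an abstract notion of structure on
    a module that passes to direct limits. *)

Section MkLin.
Variables (R : pzRingType) (U V : lmodType R) (f : U -> V) (fP : linear f).
Definition lin_fun of linear f := f.
HB.instance Definition _ := GRing.isLinear.Build R U V *:%R (lin_fun fP) fP.
Definition mklin : {linear U -> V} := lin_fun fP.
Lemma mklinE x : mklin x = f x. Proof. by []. Qed.
End MkLin.

(** * Submodules, quotients and products *)

Section Constructions.
Variable R : comNzRingType.

Definition submod (M : lmodType R) (P : M -> Prop) : Prop :=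
  P 0 /\ forall a x y, P x -> P y -> P (a *: x + y).

Section SubmodTheory.
Variables (M : lmodType R) (P : M -> Prop) (sP : submod P).
Lemma submod0 : P 0. Proof. by case: sP. Qed.
Lemma submodD x y : P x -> P y -> P (x + y).
Proof. by move=> Px Py; rewrite -[x]scale1r; apply: sP.2. Qed.
Lemma submodZ a x : P x -> P (a *: x).
Proof. by move=> Px; rewrite -[_ *: _]addr0; apply: sP.2 => //; exact: submod0. Qed.
Lemma submodN x : P x -> P (- x).
Proof. by rewrite -scaleN1r; exact: submodZ. Qed.
Lemma submodB x y : P x -> P y -> P (x - y).
Proof. by move=> Px /submodN; exact: submodD. Qed.
Lemma submodBC x y : P (x - y) -> P (y - x).
Proof. by move=> /submodN; rewrite opprB. Qed.
End SubmodTheory.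

Section SubObj.
Variables (M : lmodType R) (P : M -> Prop) (sP : submod P).
Definition submod_pred of submod P : {pred M} := fun x => `[< P x >].
Fact submod_pred_closed : submod_closed (submod_pred sP).
Proof.
split=> [|a x y]; rewrite /submod_pred !unfold_in; first by apply/asboolP; case: sP.
by move=> /asboolP Px /asboolP Py; apply/asboolP; case: sP => _; apply.
Qed.
HB.instance Definition _ :=
  GRing.isSubmodClosed.Build R M (submod_pred sP) submod_pred_closed.
Record subobj := SubObj { subobj_val : M; _ : subobj_val \in submod_pred sP }.
HB.instance Definition _ := [isSub for subobj_val].
HB.instance Definition _ := [Choice of subobj by <:].
HB.instance Definition _ := [SubChoice_isSubLmodule of subobj by <:].

Lemma sub_exists : exists (K : lmodType R) (i : {linear K -> M}),
  injective i /\ forall x, P x <-> exists y, x = i y.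
Proof.
exists (subobj : lmodType R), (val : {linear subobj -> M}); split; first exact: val_inj.
move=> x; split=> [Px|[y ->]]; last by apply/asboolP; exact: (valP y).
have Px' : x \in submod_pred sP by apply/asboolP.
by exists (SubObj Px').
Qed.
End SubObj.

Section QuotObj.
Variables (M : lmodType R) (P : M -> Prop) (sP : submod P).
Let pickP (p : M -> Prop) : M := if pselect (exists y, p y) is left h then sval (cid h) else 0.
(** The choice is made from the predicate [fun y => P (x - y)], which by extensionality is the same
    predicate for congruent x. So [qrep] is constant on classes, and the quotient is the subtype of
    its fixed points, which inherits equality and choice from M. *)
Definition qrep of submod P := fun x => pickP (fun y => P (x - y)).

Fact qrepP x : P (x - qrep sP x).
Proof.
rewrite /qrep /pickP; case: pselect => [h|[]]; first by case: cid.
by exists x; rewrite subrr; exact: submod0.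
Qed.
Fact qrep_eq x y : P (x - y) -> qrep sP x = qrep sP y.
Proof.
move=> Pxy; rewrite /qrep; congr (pickP _); apply: funext => z; apply: propext; split=> h.
  by rewrite -[y](subrK x) -addrA; apply: (submodD sP) => //; apply: submodBC.
by rewrite -[x](subrK y) -addrA; apply: submodD.
Qed.
Record quot := Quot { quot_val : M; _ : qrep sP quot_val == quot_val }.
HB.instance Definition _ := [isSub for quot_val].
HB.instance Definition _ := [Choice of quot by <:].

Fact qrep_idem x : qrep sP (qrep sP x) == qrep sP x.
Proof. by apply/eqP/qrep_eq/(submodBC sP)/qrepP. Qed.
Definition qpi x : quot := Quot (qrep_idem x).

Fact qpi_eq x y : qpi x = qpi y <-> P (x - y).
Proof.
split=> [/(congr1 val)/= e|/qrep_eq e]; last exact: val_inj.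
rewrite -[x](subrK (qrep sP x)) -addrA; apply: (submodD sP); rewrite ?e //; first by rewrite -e;
  apply: qrepP.
by exact: (submodBC sP (qrepP _)).
Qed.
Fact qpi_val u : qpi (val u) = u.
Proof. by apply: val_inj => /=; apply/eqP; exact: (valP u). Qed.

Definition qadd (u v : quot) := qpi (val u + val v).
Definition qopp (u : quot) := qpi (- val u).
Definition qscale (a : R) (u : quot) := qpi (a *: val u).
Fact qaddE x y : qadd (qpi x) (qpi y) = qpi (x + y).
Proof.
by apply/qpi_eq; rewrite opprD addrACA; apply: (submodD sP);
  exact: (submodBC sP (qrepP _)).
Qed.
Fact qoppE x : qopp (qpi x) = qpi (- x).
Proof. by apply/qpi_eq; rewrite -opprD; apply: (submodN sP); exact: (submodBC sP (qrepP _)). Qed.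
Fact qscaleE a x : qscale a (qpi x) = qpi (a *: x).
Proof. by apply/qpi_eq; rewrite -scalerBr; apply: (submodZ sP); exact: (submodBC sP (qrepP _)). Qed.
Fact quotW (A : quot -> Prop) : (forall x, A (qpi x)) -> forall u, A u.
Proof. by move=> h u; rewrite -(qpi_val u). Qed.

Fact qaddA : associative qadd.
Proof. by elim/quotW=> x; elim/quotW=> y; elim/quotW=> z; rewrite !qaddE addrA. Qed.
Fact qaddC : commutative qadd.
Proof. by elim/quotW=> x; elim/quotW=> y; rewrite !qaddE addrC. Qed.
Fact qadd0 : left_id (qpi 0) qadd.
Proof. by elim/quotW=> x; rewrite !qaddE add0r. Qed.
Fact qaddN : left_inverse (qpi 0) qopp qadd.
Proof. by elim/quotW=> x; rewrite qoppE qaddE addNr. Qed.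
HB.instance Definition _ := GRing.isZmodule.Build quot qaddA qaddC qadd0 qaddN.

Fact qscaleA a b v : qscale a (qscale b v) = qscale (a * b) v.
Proof. by elim/quotW: v => x; rewrite !qscaleE scalerA. Qed.
Fact qscale1 : left_id 1 qscale.
Proof. by elim/quotW=> x; rewrite !qscaleE scale1r. Qed.
Fact qscaleDr : right_distributive qscale +%R.
Proof. by move=> a; elim/quotW=> x; elim/quotW=> y;
  rewrite [_ + _]qaddE !qscaleE [RHS]qaddE scalerDr. Qed.
Fact qscaleDl v : {morph qscale^~ v : a b / a + b}.
Proof. by elim/quotW: v => x a b; rewrite !qscaleE [RHS]qaddE scalerDl. Qed.
HB.instance Definition _ := GRing.Zmodule_isLmodule.Build R quot
  qscaleA qscale1 qscaleDr qscaleDl.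
Fact qpi_linear : linear qpi.
Proof. by move=> a x y;
  rewrite -[_ + _ in RHS]/(qadd (qscale a (qpi x)) (qpi y)) qscaleE qaddE. Qed.

Lemma quot_exists : exists (Q : lmodType R) (p : {linear M -> Q}),
  (forall y, exists x, p x = y) /\ forall x, p x = 0 <-> P x.
Proof.
exists (quot : lmodType R), (mklin qpi_linear); split.
  by elim/quotW=> x; exists x.
by move=> x; rewrite mklinE -[0]/(qpi 0) qpi_eq subr0.
Qed.
End QuotObj.

Section DepProd.
Variables (I : Type) (M : I -> lmodType R).
Definition dprod := forall i, M i.
HB.instance Definition _ := gen_eqMixin dprod.
HB.instance Definition _ := gen_choiceMixin dprod.
Definition dadd (u v : dprod) : dprod := fun i => u i + v i.
Definition dopp (u : dprod) : dprod := fun i => - u i.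
Definition dscale (a : R) (u : dprod) : dprod := fun i => a *: u i.
Fact dfunext (u v : dprod) : (forall i, u i = v i) -> u = v.
Proof. exact: functional_extensionality_dep. Qed.
Fact daddA : associative dadd.
Proof. by move=> u v w; apply: dfunext => i; rewrite /dadd addrA. Qed.
Fact daddC : commutative dadd.
Proof. by move=> u v; apply: dfunext => i; rewrite /dadd addrC. Qed.
Fact dadd0 : left_id (fun i => 0 : M i) dadd.
Proof. by move=> u; apply: dfunext => i; rewrite /dadd add0r. Qed.
Fact daddN : left_inverse (fun i => 0 : M i) dopp dadd.
Proof. by move=> u; apply: dfunext => i; rewrite /dadd addNr. Qed.
HB.instance Definition _ := GRing.isZmodule.Build dprod daddA daddC dadd0 daddN.
Fact dscaleA a b v : dscale a (dscale b v) = dscale (a * b) v.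
Proof. by apply: dfunext => i; rewrite /dscale scalerA. Qed.
Fact dscale1 : left_id 1 dscale.
Proof. by move=> v; apply: dfunext => i; rewrite /dscale scale1r. Qed.
Fact dscaleDr : right_distributive dscale +%R.
Proof. by move=> a u v; apply: dfunext => i; rewrite /dscale scalerDr. Qed.
Fact dscaleDl v : {morph dscale^~ v : a b / a + b}.
Proof. by move=> a b; apply: dfunext => i; rewrite /dscale scalerDl. Qed.
HB.instance Definition _ := GRing.Zmodule_isLmodule.Build R dprod
  dscaleA dscale1 dscaleDr dscaleDl.
Lemma dprodDE (u v : dprod) i : (u + v) i = u i + v i. Proof. by []. Qed.
Lemma dprodZE a (u : dprod) i : (a *: u) i = a *: u i. Proof. by []. Qed.
Lemma dprod0E i : (0 : dprod) i = 0. Proof. by []. Qed.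
End DepProd.

Lemma lin_factor (A B C : lmodType R) (q : {linear A -> B}) (g : {linear A -> C}) :
  (forall b, exists a, q a = b) -> (forall a, q a = 0 -> g a = 0) ->
  exists h : {linear B -> C}, forall a, h (q a) = g a.
Proof.
move=> qs qg; have [s sP] := choice qs.
have gE a a' : q a = q a' -> g a = g a'.
  by move=> e; apply/eqP; rewrite -subr_eq0 -linearB qg // linearB e subrr.
have hl : linear (fun b => g (s b)).
  by move=> c x y /=; rewrite -linearP; apply: gE; rewrite linearP !sP.
by exists (mklin hl) => a; rewrite mklinE; apply: gE.
Qed.

Lemma lin_corestrict (A B C : lmodType R) (i : {linear A -> B}) (g : {linear C -> B}) :
  injective i -> (forall c, exists a, g c = i a) ->
  exists h : {linear C -> A}, forall c, i (h c) = g c.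
Proof.
move=> ii gi; have [s sP] := choice gi.
have hl : linear s by move=> c x y; apply: ii; rewrite linearP -!sP linearP.
by exists (mklin hl) => a; rewrite mklinE sP.
Qed.

Lemma lin_inj (A B : lmodType R) (f : {linear A -> B}) :
  (forall x, f x = 0 -> x = 0) -> injective f.
Proof.
by move=> h x y e; apply/eqP; rewrite -subr_eq0; apply/eqP/h; rewrite linearB e subrr.
Qed.

Lemma inj_lin0 (A B : lmodType R) (f : {linear A -> B}) x :
  injective f -> f x = 0 -> x = 0.
Proof. by move=> fi e; apply: fi; rewrite e linear0. Qed.

Lemma submod_ker (A B : lmodType R) (f : {linear A -> B}) : submod (fun x => f x = 0).
Proof. by split=> [|a x y]; rewrite ?linear0 // linearP => -> ->; rewrite scaler0 addr0. Qed.

Lemma submod_im (A B : lmodType R) (f : {linear A -> B}) :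
  submod (fun y => exists x, y = f x).
Proof.
by split=> [|a x y [x1 ->] [x2 ->]]; [exists 0; rewrite linear0 | exists (a *: x1 + x2);
  rewrite linearP].
Qed.

Lemma submod_imP (A B : lmodType R) (f : {linear A -> B}) (P : A -> Prop) :
  submod P -> submod (fun y => exists2 x, P x & y = f x).
Proof.
move=> sP; split=> [|a x y [x1 ? ->] [x2 ? ->]].
  by exists 0; rewrite ?linear0 //; exact: submod0.
by exists (a *: x1 + x2); rewrite ?linearP //; apply sP.2.
Qed.

Lemma ker_exists (A B : lmodType R) (f : {linear A -> B}) :
  exists (K : lmodType R) (i : {linear K -> A}),
  injective i /\ forall x, f x = 0 <-> exists y, x = i y.
Proof. exact: sub_exists (submod_ker f). Qed.

Lemma coker_exists (A B : lmodType R) (f : {linear A -> B}) :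
  exists (Q : lmodType R) (p : {linear B -> Q}),
  (forall y, exists x, p x = y) /\ forall x, p x = 0 <-> exists y, x = f y.
Proof. exact: quot_exists (submod_im f). Qed.

Lemma proj_cover_exists (A : lmodType R) :
  exists (P : lmodType R) (p : {linear P -> A}), projective P /\ forall y, exists x, p x = y.
Proof.
exists ({freeg A / R} : lmodType R), (fglift (@id A)); split; first exact: freeg_projective.
by move=> y; exists << y >>; rewrite /= liftU scale1r.
Qed.

Definition ses (A B C : lmodType R) (f : {linear A -> B}) (g : {linear B -> C}) : Prop :=
  [/\ injective f, forall y, g y = 0 <-> exists x, y = f x & forall z, exists y, g y = z].

Lemma ses_comp0 (A B C : lmodType R) (f : {linear A -> B}) (g : {linear B -> C}) x :
  ses f g -> g (f x) = 0.
Proof. by case=> _ h _; apply/h; exists x. Qed.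

End Constructions.

(** Bounds are asked only of nonempty chains; [t0] bounds the empty one. Maximality is up to the
    equivalence of the preorder. *)
Lemma Zorn_preorder (T : Type) (t0 : T) (le : T -> T -> Prop) :
  (forall t, le t t) -> (forall r s t, le r s -> le s t -> le r t) ->
  (forall A : T -> Prop, (exists t, A t) -> (forall s t, A s -> A t -> le s t \/ le t s) ->
     exists t, forall s, A s -> le s t) ->
  exists t, forall s, le t s -> le s t.
Proof.
move=> le_refl le_trans ub.
have [|r s t /asboolP rs /asboolP st||t tP] := @ZL_preorder T t0 (fun x y => `[< le x y >]).
- by move=> t; apply/asboolP.
- by apply/asboolP/(le_trans _ _ _ rs st).
- move=> A At; have [[a Aa]|nA] := pselect (exists t, A t); last first.
    by exists t0 => s As; case: nA; exists s.
  have [||t tP] := ub A; first by exists a.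
    by move=> x y Ax Ay; case: (At x y Ax Ay) => /asboolP; [left|right].
  by exists t => s As; apply/asboolP/tP.
by exists t => s ts; apply/asboolP/tP/asboolP.
Qed.

(** * Vanishing of Ext *)

Section Ext1.
Variable R : comNzRingType.

Lemma pullback_exists (A B C : lmodType R) (f : {linear A -> C}) (g : {linear B -> C}) :
  exists (P : lmodType R) (pa : {linear P -> A}) (pb : {linear P -> B}),
  [/\ forall x, f (pa x) = g (pb x),
      forall a b, f a = g b -> exists x, pa x = a /\ pb x = b
    & forall x, pa x = 0 -> pb x = 0 -> x = 0].
Proof.
pose F (b : bool) : lmodType R := if b then A else B.
pose D : lmodType R := dprod F.
have la : linear (fun u : D => u true : A) by [].
have lb : linear (fun u : D => u false : B) by [].
have lh : linear (fun u : D => f (u true) - g (u false)).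
  by move=> a x y; rewrite !dprodDE !dprodZE !linearP scalerDr addrACA.
have [P [i [ii iE]]] := ker_exists (mklin lh).
exists P, (mklin la \o i), (mklin lb \o i); split=> /=.
- move=> x; apply/eqP; rewrite -subr_eq0; apply/eqP.
  by apply: (iE (i x)).2; exists x.
- move=> a b e.
  pose u : D := fun c => if c return F c then a else b.
  have [|x xE] := (iE u).1; first by rewrite mklinE /u e subrr.
  by exists x; rewrite !mklinE -xE.
move=> x; rewrite !mklinE => e1 e2; apply: (inj_lin0 ii).
by apply: dfunext => -[]; rewrite dprod0E.
Qed.

Definition injective_module (J : lmodType R) : Prop :=
  forall (A B : lmodType R) (i : {linear A -> B}) (f : {linear A -> J}),
    injective i -> exists g : {linear B -> J}, forall x, g (i x) = f x.

(** Ext^1(A, M) = 0 without resolutions. Any B over A is allowed, not only a projective one, so the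
    condition applies directly to an injective hull and its cokernel. *)
Definition ext1_vanish (A M : lmodType R) : Prop :=
  forall (K B : lmodType R) (i : {linear K -> B}) (p : {linear B -> A}),
    ses i p -> forall f : {linear K -> M},
    exists g : {linear B -> M}, forall x, g (i x) = f x.

(** One projective presentation tests all of them: lifting p through q makes B the pushout of P and
    K' along K, so a map on B is a pair of maps on P and K' that agree on K. *)
Lemma ext1_vanish_proj (A M K P : lmodType R) (i : {linear K -> P}) (p : {linear P -> A}) :
  projective P -> ses i p ->
  (forall f : {linear K -> M}, exists g : {linear P -> M}, forall x, g (i x) = f x) ->
  ext1_vanish A M.
Proof.
move=> prP s ext K' B j q s' f.
have [ii ei si] := s; have [ji ej sj] := s'.
have [l lE] := prP _ _ q p sj.
have [|l' l'E] := @lin_corestrict _ _ _ _ j (l \o i) ji.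
  by move=> c; apply/ej; rewrite /= lE ses_comp0.
have [g gE] := ext (f \o l').
have {}gE x : g (i x) = f (l' x) by rewrite gE.
(* Two decompositions b = l x + j k differ by some z in K, with x changed by i z and k by l' z, so g
   x + f k is unchanged. *)
have key b : exists m, forall x k, p x = q b -> b = l x + j k -> m = g x + f k.
  have [x xb] := si (q b).
  have [|k kE] := (ej (b - l x)).1; first by rewrite linearB lE xb subrr.
  exists (g x + f k) => x' k' x'b bE.
  have [|z zE] := (ei (x' - x)).1; first by rewrite linearB x'b xb subrr.
  have -> : x' = i z + x by rewrite -zE subrK.
  have kk : k = l' z + k'.
    apply: ji; rewrite -kE {1}bE linearD l'E /= -zE linearB.
    by rewrite addrAC.
  by rewrite kk !linearD gE addrCA addrA.
have [h hE] := choice key.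
have dec b : exists x k, p x = q b /\ b = l x + j k.
  have [x xb] := si (q b).
  have [|k kE] := (ej (b - l x)).1; first by rewrite linearB lE xb subrr.
  by exists x, k; split=> //; rewrite -kE addrC subrK.
have hl : linear h.
  move=> a b b'; have [x [k [xb bE]]] := dec b; have [x' [k' [xb' bE']]] := dec b'.
  rewrite (hE b x k) // (hE b' x' k') // (hE _ (a *: x + x') (a *: k + k')).
  - by rewrite !linearP scalerDr addrACA.
  - by rewrite !linearP xb xb'.
  by rewrite !linearP {1}bE {1}bE' scalerDr addrACA.
exists (mklin hl) => k; rewrite mklinE (hE _ 0 k) ?linear0 ?add0r //.
by rewrite ses_comp0.
Qed.

(** Vanishing seen by one fixed resolution, whereas [Ext_eq0] quantifies over all; [cohom0_indep]
    reconciles the two. *)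
Definition cohom0 (N : lmodType R) (P : projective_resolution N) (i : nat) (M : lmodType R) : Prop :=
  forall f : {linear res_term P i -> M}, cocycle f -> coboundary f.

(** P_1 maps onto the first syzygy K with kernel the image of P_2. So 1-cocycles are the maps K ->
    M, and coboundaries are those that extend to P_0. *)
Lemma cohom0_1P (A M : lmodType R) (P : projective_resolution A) :
  cohom0 P 1 M <-> ext1_vanish A M.
Proof.
have [K [i [ii ei]]] := ker_exists (res_aug P).
have s : ses i (res_aug P) by split=> //; exact: res_aug_surj.
have [|l lE] := @lin_corestrict _ _ _ _ i (res_d P 0) ii.
  by move=> c; apply/ei; apply/res_exact0; exists c.
split=> e.
  apply: (ext1_vanish_proj (@res_projective _ _ P 0) s) => f.
  have [y|g gE] := e (f \o l).
    rewrite /=; have -> : l (res_d P 1 y) = 0; last exact: linear0.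
    by apply: (inj_lin0 ii); rewrite lE; apply/res_exact; exists y.
  exists g => x; have /res_exact0[y yE] : res_aug P (i x) = 0 by rewrite ses_comp0.
  by rewrite yE -gE /=; congr (f _); apply: ii; rewrite lE.
move=> f fc; have [k|x lx|u uE] := @lin_factor _ _ _ _ l f.
- have /res_exact0[y yE] : res_aug P (i k) = 0 by rewrite ses_comp0.
  by exists y; apply: ii; rewrite lE.
- have /res_exact[y ->] : res_d P 0 x = 0 by rewrite -lE lx linear0.
  exact: fc.
have [g gE] := e _ _ _ _ s u.
by exists g => x; rewrite -lE gE uE.
Qed.

Lemma Ext_eq0_1P (A M : lmodType R) : Ext_eq0 1 A M <-> ext1_vanish A M.
Proof.
split=> [e|e P]; last exact/cohom0_1P.
by have [P] := projective_resolution_exists A; apply/cohom0_1P/(e P).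
Qed.

Lemma ext1_vanish_inj (A J : lmodType R) : injective_module J -> ext1_vanish A J.
Proof. by move=> Ji K B i p [ii _ _] f; apply: Ji. Qed.

Lemma ext1_vanish_ext (A K M C : lmodType R) (i : {linear K -> M}) (p : {linear M -> C}) :
  ses i p -> ext1_vanish A K -> ext1_vanish A C -> ext1_vanish A M.
Proof.
move=> [ii ei si] eK eC; have [P [q [prP qs]]] := proj_cover_exists A.
have [L [j [ji ej]]] := ker_exists q.
have s : ses j q by [].
apply: (ext1_vanish_proj prP s) => f.
have [g gE] := eC _ _ _ _ s (p \o f).
have [g' g'E] := prP _ _ p g si.
have [c|h hE] := @lin_corestrict _ _ _ _ i (f \- (g' \o j)) ii.
  by apply/ei; rewrite /= linearB g'E gE subrr.
have [h' h'E] := eK _ _ _ _ s h.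
by exists (g' \+ (i \o h')) => x /=; rewrite h'E hE /= addrC subrK.
Qed.

(** The pullback of p along f is an extension of A by K, which splits: the extension h' of its
    kernel map corrects [pa] so that it descends to A. *)
Lemma ext1_vanish_lift (A K M C : lmodType R) (i : {linear K -> M}) (p : {linear M -> C})
    (f : {linear A -> C}) :
  ses i p -> ext1_vanish A K -> exists g : {linear A -> M}, forall x, p (g x) = f x.
Proof.
move=> [ii ei si] eK.
have [P [pa [pb [pE pex pinj]]]] := pullback_exists p f.
have pbs b : exists x, pb x = b.
  by have [m mE] := si (f b); have [x [_ xE]] := pex m b mE; exists x.
have [L [j [ji ej]]] := ker_exists pb.
have s : ses j pb by [].
have [c|h hE] := @lin_corestrict _ _ _ _ i (pa \o j) ii.
  by apply/ei; rewrite /= pE (ses_comp0 _ s) linear0.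
have [h' h'E] := eK _ _ _ _ s h.
have [x|g gE] := @lin_factor _ _ _ _ pb (pa \- (i \o h')) pbs.
  by move=> /ej[y ->] /=; rewrite h'E hE /= subrr.
exists g => a; have [x <-] := pbs a.
by rewrite gE /= linearB pE (_ : p (i _) = 0) ?subr0 //; apply/ei; exists (h' x).
Qed.

End Ext1.

(** * Long exact cohomology sequence for a fixed resolution *)

Section LongExact.
Variables (R : comNzRingType) (N : lmodType R) (P : projective_resolution N).

Variables (A B C : lmodType R) (f : {linear A -> B}) (g : {linear B -> C}).
Hypothesis s : ses f g.

Lemma cohom0_left0 : cohom0 P 0 B -> cohom0 P 0 A.
Proof.
move=> hB u uc x; have [fi _ _] := s.
apply: (inj_lin0 fi); apply: (hB (f \o u)) => y /=.
by rewrite uc linear0.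
Qed.

(** The cochain v bounds f u in B, and g v is a cocycle of C; when that bounds, v can be corrected
    until it takes values in A. It is stated for a single u because [depth_ge_regular] has such a v
    for each cocycle without knowing that the cohomology of B vanishes. *)
Lemma coboundary_left i (u : {linear res_term P i.+1 -> A})
    (v : {linear res_term P i -> B}) :
  cohom0 P i C -> (forall x, f (u x) = v (res_d P i x)) -> coboundary u.
Proof.
move=> hC vE; have [fi ef gs] := s.
suff [w [wE w0]] : exists w : {linear res_term P i -> B},
    (forall x, w (res_d P i x) = f (u x)) /\ forall x, g (w x) = 0.
  have [c|w' w'E] := @lin_corestrict _ _ _ _ f w fi; first exact/ef.
  by exists w' => x; apply: fi; rewrite w'E wE.
have gc : cocycle (g \o v) by move=> y /=; rewrite -vE ses_comp0.
(* In degree 0 a coboundary is zero, so v already works; in higher degree g v = h d, and a lift of h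
   through g is subtracted. *)
have := hC _ gc; case: i u v vE hC {gc} => [|i] u v vE hC /=.
  by move=> gv; exists v; split=> // x; rewrite vE.
move=> [h hE]; have [h' h'E] := @res_projective _ _ P _ _ _ _ h gs.
exists (v \- (h' \o res_d P i)); split=> x /=; last by rewrite linearB h'E -hE subrr.
rewrite (_ : res_d P i (res_d P i.+1 x) = 0) ?linear0 ?subr0 ?oppr0 ?addr0 ?vE //.
by apply/res_exact; exists x.
Qed.

Lemma cohom0_left i : cohom0 P i C -> cohom0 P i.+1 B -> cohom0 P i.+1 A.
Proof.
move=> hC hB u uc.
have [y|v vE] := hB (f \o u); first by rewrite /= uc linear0.
by apply: (@coboundary_left i u v hC) => x; rewrite -vE.
Qed.

Lemma cohom0_right i : cohom0 P i B -> cohom0 P i.+1 A -> cohom0 P i C.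
Proof.
move=> hB hA u uc; have [fi ef gs] := s.
have [u' u'E] := @res_projective _ _ P i _ _ _ u gs.
have [c|w wE] := @lin_corestrict _ _ _ _ f (u' \o res_d P i) fi.
  by apply/ef; rewrite /= u'E uc.
have [y|v vE] := hA w.
  apply: fi; rewrite wE /= (_ : res_d P i (res_d P i.+1 y) = 0) ?linear0 //.
  by apply/res_exact; exists y.
have cc : cocycle (u' \- (f \o v)) by move=> y /=; rewrite -vE wE /= subrr.
have := hB _ cc; case: i u uc u' u'E w wE v vE cc hA hB => [|i] u uc u' u'E w wE v vE cc hA hB /=.
  move=> e x; rewrite -u'E; move/eqP: (e x); rewrite subr_eq0 => /eqP->.
  by rewrite ses_comp0.
move=> [h hE]; exists (g \o h) => x /=;
  rewrite -hE /= linearB u'E (ses_comp0 _ s) ?oppr0 ?addr0 ?subr0 //.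

Qed.

End LongExact.

Section LongExact2.
Variables (R : comNzRingType) (N : lmodType R).
Implicit Type P Q : projective_resolution N.

Lemma cohom0_inj P i (J : lmodType R) : injective_module J -> cohom0 P i.+1 J.
Proof.
move=> Ji u uc.
have [K [j [ji ej]]] : exists (K : lmodType R) (j : {linear K -> res_term P i}),
  injective j /\ forall x, (exists y, x = res_d P i y) <-> exists y, x = j y.
  exact: sub_exists (submod_im _).
have [c|l lE] := @lin_corestrict _ _ _ _ j (res_d P i) ji.
  by apply/ej; exists c.
have [k|x lx|v vE] := @lin_factor _ _ _ _ l u.
- have /ej[y yE] : exists y, j k = j y by exists k.
  by exists y; apply: ji; rewrite lE.
- have /res_exact[y ->] : res_d P i x = 0 by rewrite -lE lx linear0.
  exact: uc.
have [w wE] := Ji _ _ j v ji.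
by exists w => x; rewrite -vE -wE lE.
Qed.

Lemma cohom0_0P P (M : lmodType R) :
  cohom0 P 0 M <-> forall (u : {linear N -> M}) x, u x = 0.
Proof.
split=> [h u x|h u uc x].
  have [y <-] := res_aug_surj P x.
  apply: (h (u \o res_aug P)) => z /=.
  by rewrite (_ : res_aug P _ = 0) ?linear0 //; apply/res_exact0; exists z.
have [y /res_exact0[z ->]|v vE] := @lin_factor _ _ _ _ (res_aug P) u (@res_aug_surj _ _ P).
  exact: uc.
by rewrite -vE h.
Qed.

End LongExact2.

(** * Injective modules *)

Section PartialMaps.
Variables (R : comNzRingType) (B N : lmodType R).

(** A domain and a total function of which only the values on the domain count. Since [pmap_le]
    ignores the other values, it is only a preorder. *)
Definition pmap : Type := (B -> Prop) * (B -> N).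
Implicit Types s t : pmap.

Definition pmap_ok t : Prop :=
  submod t.1 /\ forall a x y, t.1 x -> t.1 y -> t.2 (a *: x + y) = a *: t.2 x + t.2 y.

Definition pmap_le s t : Prop := forall x, s.1 x -> t.1 x /\ t.2 x = s.2 x.

Definition pmap_union (A : pmap -> Prop) t : Prop :=
  (forall x, t.1 x <-> exists2 s, A s & s.1 x) /\ forall s, A s -> pmap_le s t.

Definition pmap_chain (A : pmap -> Prop) : Prop :=
  (exists s, A s) /\ forall s t, A s -> A t -> pmap_le s t \/ pmap_le t s.

Lemma pmap_le_refl t : pmap_le t t. Proof. by []. Qed.
Lemma pmap_le_trans s t u : pmap_le s t -> pmap_le t u -> pmap_le s u.
Proof. by move=> st tu x sx; have [tx <-] := st x sx; have [] := tu x tx. Qed.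

Lemma pmap_union_ok A t :
  pmap_chain A -> (forall s, A s -> pmap_ok s) -> pmap_union A t -> pmap_ok t.
Proof.
move=> [[s0 As0] Ac] Aok [tE tu].
have two x y : t.1 x -> t.1 y -> exists s, [/\ A s, s.1 x & s.1 y].
  move=> /tE[s1 A1 sx] /tE[s2 A2 sy]; have [l|l] := Ac _ _ A1 A2.
    by exists s2; split=> //; have [] := l x sx.
  by exists s1; split=> //; have [] := l y sy.
split.
  split=> [|a x y tx ty]; first by apply/tE; exists s0 => //; case: (Aok _ As0) => -[].
  have [s [As sx sy]] := two x y tx ty; apply/tE; exists s => //.
  by case: (Aok _ As) => -[_ h] _; exact: h.
move=> a x y tx ty; have [s [As sx sy]] := two x y tx ty.
have [ss sl] := Aok _ As.
by rewrite (tu _ As x sx).2 (tu _ As y sy).2 -sl // (tu _ As _ (ss.2 a x y sx sy)).2.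
Qed.

(** Q is left open because two arguments use it: Baer's criterion, and the lifting to a sum of
    hulls, where the domains must moreover be injective. *)
Lemma pmap_zorn (Q : pmap -> Prop) t0 :
  Q t0 ->
  (forall A t, pmap_chain A -> (forall s, A s -> Q s) -> pmap_union A t -> Q t) ->
  exists t, Q t /\ forall s, Q s -> pmap_le t s -> pmap_le s t.
Proof.
move=> Q0 QU; pose T := {t | Q t}.
have [||| [t Qt] tmax] :=
  @Zorn_preorder T (exist _ t0 Q0) (fun a b : T => pmap_le (sval a) (sval b)).
- by move=> t; apply: pmap_le_refl.
- by move=> r s t; apply: pmap_le_trans.
- move=> A [s0 As0] Ac; pose A' s := exists Qs : Q s, A (exist _ s Qs).
  have chA : pmap_chain A'.
    split; first by case: s0 As0 => s Qs As; exists s, Qs.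
    by move=> s t [Qs As] [Qt At]; have := Ac _ _ As At.
  have key x : exists y, forall s, A' s -> s.1 x -> s.2 x = y.
    have [[s As sx]|no] := pselect (exists2 s, A' s & s.1 x); last first.
      by exists 0 => s As sx; case: no; exists s.
    exists (s.2 x) => t At tx; have [l|l] := chA.2 _ _ As At; first by have [] := l x sx.
    by have [] := l x tx.
  have [h hE] := choice key.
  pose u : pmap := (fun x => exists2 s, A' s & s.1 x, h).
  have uU : pmap_union A' u.
    split=> // s As x sx; split; first by exists s.
    by rewrite /= (hE _ s).
  have Qu : Q u by apply: QU uU => // s [].
  exists (exist _ u Qu) => -[s Qs] As /=; apply: uU.2; by exists Qs.
by exists t; split=> // s Qs; apply: (tmax (exist _ s Qs)).
Qed.

(** Agreement on the overlap includes ker u, where it forces v to vanish; so u may be r -> r *: z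
    for a torsion element z. *)
Lemma pmap_extend (H : lmodType R) t (u : {linear H -> B}) (v : {linear H -> N}) :
  pmap_ok t -> (forall e, t.1 (u e) -> t.2 (u e) = v e) ->
  exists t', [/\ pmap_ok t', pmap_le t t',
    (forall x, t'.1 x <-> exists d e, t.1 d /\ x = d + u e)
    & forall d e, t.1 d -> t'.2 (d + u e) = t.2 d + v e].
Proof.
move=> [st lt] uv.
have lB x y : t.1 x -> t.1 y -> t.2 (x - y) = t.2 x - t.2 y.
  by move=> tx ty; rewrite -scaleN1r addrC lt // scaleN1r addrC.
have key x : exists y, forall d e, t.1 d -> x = d + u e -> y = t.2 d + v e.
  have [[d [e [td xE]]]|no] := pselect (exists d e, t.1 d /\ x = d + u e); last first.
    by exists 0 => d e td xE; case: no; exists d, e.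
  exists (t.2 d + v e) => d' e' td'; rewrite xE => E.
  have E' : u (e' - e) = d - d'.
    by rewrite linearB -[in RHS](addrK (u e) d) E addrAC [d' + _]addrC addrK.
  have tE : t.1 (u (e' - e)) by rewrite E'; exact: (submodB st).
  have := uv _ tE; rewrite E' lB // linearB => /eqP.
  by rewrite subr_eq addrAC -subr_eq opprK addrC => /eqP->; rewrite addrC.
have [h hE] := choice key.
pose t' : pmap := (fun x => exists d e, t.1 d /\ x = d + u e, h).
have t'E d e : t.1 d -> t'.2 (d + u e) = t.2 d + v e by move=> td; rewrite /= (hE _ d e).
have t0 : t.2 0 = 0 by rewrite -[0 in LHS](subrr 0) lB ?subrr //; exact: (submod0 st).
exists t'; split=> //.
- split=> [|a _ _ [d [e [td ->]]] [d' [e' [td' ->]]]].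
    split=> [|a _ _ [d [e [td ->]]] [d' [e' [td' ->]]]].
      by exists 0, 0; rewrite linear0 addr0; split=> //; exact: (submod0 st).
    exists (a *: d + d'), (a *: e + e'); split; first exact: st.2.
    by rewrite linearP scalerDr addrACA.
  rewrite scalerDr addrACA -linearP !t'E //; last exact: st.2.
  by rewrite lt // linearP scalerDr addrACA.
- move=> x tx; split; first by exists x, 0; rewrite linear0 addr0.
  by rewrite -[x in LHS]addr0 -(linear0 u) t'E // linear0 addr0.
Qed.

End PartialMaps.

Section Baer.
Variable R : comNzRingType.

(** Baer's condition for a subset D of M, so that injective submodules can be united inside one
    ambient module without forming subobjects. *)
Definition baer (M : lmodType R) (D : M -> Prop) : Prop :=
  forall (I : R^o -> Prop) (f : R -> M), submod I -> (forall r, I r -> D (f r)) ->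
    (forall a r s, I r -> I s -> f (a * r + s) = a *: f r + f s) ->
    exists2 y, D y & forall r, I r -> f r = r *: y.

Fact scale_linear (M : lmodType R) (x : M) : linear (fun r : R^o => r *: x).
Proof. by move=> a r s; rewrite scalerDl scalerA. Qed.

Lemma injective_of_baer (J : lmodType R) : baer (fun _ : J => True) -> injective_module J.
Proof.
move=> Jb A B i f ii.
have key b : exists y, forall a, b = i a -> y = f a.
  have [[a ->]|no] := pselect (exists a, b = i a); first by exists (f a) => a' /ii->.
  by exists 0 => a bE; case: no; exists a.
have [h hE] := choice key.
pose t0 : pmap B J := (fun b => exists a, b = i a, h).
have h0 a : h (i a) = f a by apply: hE.
have ok0 : pmap_ok t0.
  split=> [|a _ _ [x ->] [y ->]]; first exact: submod_im.
  by rewrite /= -linearP !h0 linearP.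
have [|A' t chA AQ tU|t [[tok t0t] tmax]] :=
  @pmap_zorn _ B J (fun t => pmap_ok t /\ pmap_le t0 t) t0.
- by split.
- split; first by apply: (pmap_union_ok chA _ tU) => s /AQ[].
  by have [[s As] _] := chA; apply: (pmap_le_trans (AQ s As).2); exact: tU.2.
have [st lt] := tok.
have tT z : t.1 z.
  (* The ideal of the r that bring z into the domain; Baer's condition on it yields an admissible
     value y at z. *)
  have [|//||y _ yE] := Jb (fun r => t.1 (r *: z)) (fun r => t.2 (r *: z)).
  - split=> [|a r s tr ts]; first by rewrite scale0r; exact: (submod0 st).
    by rewrite scalerDl -scalerA; apply: st.2.
  - by move=> a r s tr ts; rewrite scalerDl -scalerA lt.
  have [//|t' [t'ok tt' t'1 t'2]] :=
    @pmap_extend _ B J _ t (mklin (scale_linear z)) (mklin (scale_linear y)) tok.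
  apply: (tmax t' _ tt' z _).1; first by split=> //; exact: pmap_le_trans tt'.
  apply/t'1; exists 0, 1; split; first exact: (submod0 st).
  by rewrite mklinE scale1r add0r.
have tl : linear t.2 by move=> a x y; apply: lt.
exists (mklin tl) => x; rewrite mklinE -h0; apply: (t0t (i x) _).2.
by exists x.
Qed.

Lemma baer_of_injective (J : lmodType R) : injective_module J -> baer (fun _ : J => True).
Proof.
move=> Ji I f sI _ lf; have [K [i [ii iE]]] := sub_exists sI.
have fl : linear (fun x : K => f (i x)).
  by move=> a x y; rewrite linearP lf //; apply/iE; [exists x|exists y].
have [g gE] := Ji _ _ i (mklin fl) ii.
exists (g (1 : R^o)) => // r /iE[x ->].
by rewrite -linearZ (_ : i x *: (1 : R^o) = i x) ?gE //; exact: mulr1.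
Qed.

Lemma injective_retract (J M : lmodType R) (i : {linear M -> J}) (p : {linear J -> M}) :
  injective_module J -> (forall x, p (i x) = x) -> injective_module M.
Proof.
move=> Ji pi A B j f ji; have [g gE] := Ji _ _ j (i \o f) ji.
by exists (p \o g) => x; rewrite /= gE /= pi.
Qed.

Lemma baer_sub (J M : lmodType R) (i : {linear M -> J}) (D : J -> Prop) :
  injective i -> (forall x, D x <-> exists y, x = i y) -> baer D -> injective_module M.
Proof.
move=> ii iE Db; apply: injective_of_baer => I f sI _ lf.
have [//|r Ir|a r s Ir Is|y /iE[x ->] yE] := Db I (fun r => i (f r)).
- by apply/iE; exists (f r).
- by rewrite lf // linearP.
by exists x => // r Ir; apply: ii; rewrite linearZ yE.
Qed.

End Baer.

(** * Embedding a module in an injective one through divisible groups *)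

Section Divisible.

Lemma int_linear (U V : zmodType) (h : U -> V) :
  {morph h : x y / x + y} -> linear (h : zmodule U -> zmodule V).
Proof.
move=> hD; have h0 : h 0 = 0 by apply: (addIr (h 0)); rewrite -hD !add0r.
have hN x : h (- x) = - h x by apply/eqP; rewrite -addr_eq0 -hD addNr h0.
have hM x n : h (x *+ n) = h x *+ n.
  by elim: n => [|n IH]; rewrite ?mulr0n // !mulrS hD IH.
move=> a x y; rewrite hD; congr (_ + _).
by case: a => n; [exact: hM|rewrite /= -[LHS]/(h (- (x *+ n.+1))) hN hM].
Qed.

(* D is the quotient of Q^(M) by the kernel of Z^(M) -> M. *)
Lemma divisible_embedding (M : zmodType) : exists (D : lmodType int) (j : {linear zmodule M -> D}),
  injective j /\ forall (n : int) (u : D), n != 0 -> exists v, n *: v = u.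
Proof.
pose Z : lmodType int := {freeg M / int}.
pose Q : lmodType int := zmodule {freeg M / rat}.
pose phi : {linear Z -> Q} := fglift (fun m : M => (<< m >> : {freeg M / rat}) : Q).
pose psi : {linear Z -> zmodule M} := fglift (fun m : M => m : zmodule M).
have phi_inj : injective phi.
  apply: lin_inj => y; rewrite /phi /= fglift_sumE => y0.
  have coeffMz m (x : {freeg M / rat}) (n : int) : coeff m (x *~ n) = coeff m x *~ n.
    by case: n => n; [exact: coeffMn|rewrite /= -[x *~ _]/(- (x *+ n.+1)) coeffN coeffMn].
  apply/eqP/freeg_eqP => m; rewrite coeff0.
  have := congr1 (coeff m : {freeg M / rat} -> rat) y0.
  rewrite coeff0 [coeff _ _]raddf_sum /=.
  have [mD|mD] := boolP (m \in dom y); last by rewrite coeff_outdom.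
  rewrite (bigD1_seq m) ?uniq_dom //= big1 ?addr0 => [|m' m'm].
    rewrite -[coeff m y *: _]/((<< m >> : {freeg M / rat}) *~ coeff m y).
    by rewrite coeffMz coeffU eqxx mul1r => /eqP; rewrite intr_eq0 => /eqP.
  rewrite -[coeff m' y *: _]/((<< m' >> : {freeg M / rat}) *~ coeff m' y).
  by rewrite coeffMz coeffU (negbTE m'm) mulr0 mul0rz.
have psi_surj m : exists z, psi z = m by exists << m >>; rewrite /psi /= liftU scale1r.
have sK : submod (fun x : Q => exists2 z, psi z = 0 & x = phi z).
  exact: (submod_imP phi (submod_ker psi)).
have [D [p [ps pK]]] := quot_exists sK.
have [z z0|j jE] := @lin_factor _ _ _ _ psi (p \o phi) psi_surj.
  by apply/pK; exists z.
exists D, j; split.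
  apply: lin_inj => m; have [z <-] := psi_surj m; rewrite jE /= => /pK[z' z'0 /phi_inj->].
  exact: z'0.
move=> n u n0; have [x <-] := ps u.
exists (p ((n%:~R^-1 : rat) *: (x : {freeg M / rat}))); rewrite -linearZ /=; congr (p _).
rewrite -[LHS]/(((n%:~R^-1 : rat) *: (x : {freeg M / rat})) *~ n) -scaler_int scalerA.
by rewrite mulfV ?scale1r // intr_eq0.
Qed.

(** A nonzero ideal of Z is generated by its least positive element m, and a quotient of f m by m
    satisfies Baer's condition. *)
Lemma divisible_injective (D : lmodType int) :
  (forall (n : int) (u : D), n != 0 -> exists v, n *: v = u) -> injective_module D.
Proof.
move=> div; apply: injective_of_baer => I f sI _ lf.
have f0 : f 0 = 0.
  by have := lf (-1) 0 0 (submod0 sI) (submod0 sI); rewrite mulr0 addr0 scaleN1r addNr.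
have [[n In n0]|no] := pselect (exists2 n : int, I n & n != 0); last first.
  exists 0 => // r Ir; rewrite scaler0; have [->//|r0] := eqVneq r 0.
  by case: no; exists r.
have ex : exists n, (0 < n)%N && `[< I n%:Z >].
  exists `|n|%N; rewrite absz_gt0 n0; apply/asboolP.
  by case: n In {n0} => n // /(submodN sI); rewrite NegzE opprK.
have [m /andP[m0 /asboolP Im] mmin] := ex_minnP ex.
have mz : m%:Z != 0 by rewrite eqz_nat -lt0n.
have [y yE] := div m%:Z (f m%:Z) mz.
exists y => // r Ir.
have Irm : I ((r %% m)%Z : int).
  rewrite [X in I X](_ : _ = r - (r %/ m)%Z * m%:Z).
    by apply: (submodB sI) => //; exact: (submodZ sI (r %/ m)%Z Im).
  by rewrite {2}(divz_eq r m) addrC addKr.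
have rm0 : (r %% m)%Z = 0.
  have := modz_ge0 r mz; have := ltz_mod r mz.
  case: (r %% m)%Z Irm => // -[//|q] Iq; rewrite ltz_nat => qm _.
  have := mmin q.+1; rewrite (introT (asboolP _) Iq) /= => /(_ isT).
  by rewrite leqNgt qm.
rewrite {1 2}(divz_eq r m) rm0 addr0.
have := lf (r %/ m)%Z m%:Z 0 Im (submod0 sI); rewrite addr0 f0 addr0 => ->.
by rewrite -yE scalerA.
Qed.
End Divisible.

Section Coinduced.
Variables (R : comNzRingType) (D : lmodType int).

(* Hom_Z(R, D), where a acts by (a u)(r) = u (r a). *)
Record coind := Coind { coind_val : R -> D; coindD : {morph coind_val : x y / x + y} }.
HB.instance Definition _ := gen_eqMixin coind.
HB.instance Definition _ := gen_choiceMixin coind.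
Fact coind_eq (u v : coind) : coind_val u =1 coind_val v -> u = v.
Proof.
case: u v => [u uD] [v vD] /= /funext uv; move: vD; rewrite -uv => vD.
by congr Coind; exact: Prop_irrelevance.
Qed.
Fact coind_addP (u v : coind) : {morph (fun r => coind_val u r + coind_val v r) : x y / x + y}.
Proof. by move=> x y /=; rewrite !coindD addrACA. Qed.
Fact coind_0P : {morph (fun r : R => 0 : D) : x y / x + y}.
Proof. by move=> x y /=; rewrite addr0. Qed.
Fact coind_oppP (u : coind) : {morph (fun r => - coind_val u r) : x y / x + y}.
Proof. by move=> x y /=; rewrite !coindD opprD. Qed.
Fact coind_scaleP (a : R) (u : coind) : {morph (fun r => coind_val u (r * a)) : x y / x + y}.
Proof. by move=> x y /=; rewrite mulrDl !coindD. Qed.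
Definition coind_add u v := Coind (coind_addP u v).
Definition coind_0 := Coind coind_0P.
Definition coind_opp u := Coind (coind_oppP u).
Definition coind_scale a u := Coind (coind_scaleP a u).
Fact coind_addA : associative coind_add.
Proof. by move=> u v w; apply: coind_eq => r /=; rewrite addrA. Qed.
Fact coind_addC : commutative coind_add.
Proof. by move=> u v; apply: coind_eq => r /=; rewrite addrC. Qed.
Fact coind_add0 : left_id coind_0 coind_add.
Proof. by move=> u; apply: coind_eq => r /=; rewrite add0r. Qed.
Fact coind_addN : left_inverse coind_0 coind_opp coind_add.
Proof. by move=> u; apply: coind_eq => r /=; rewrite addNr. Qed.
HB.instance Definition _ := GRing.isZmodule.Build coind coind_addA coind_addC coind_add0 coind_addN.
Fact coind_scaleA a b v : coind_scale a (coind_scale b v) = coind_scale (a * b) v.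
Proof. by apply: coind_eq => r /=; rewrite mulrA. Qed.
Fact coind_scale1 : left_id 1 coind_scale.
Proof. by move=> v; apply: coind_eq => r /=; rewrite mulr1. Qed.
Fact coind_scaleDr : right_distributive coind_scale +%R.
Proof. by move=> a u v; apply: coind_eq => r. Qed.
Fact coind_scaleDl v : {morph coind_scale^~ v : a b / a + b}.
Proof. by move=> a b; apply: coind_eq => r /=; rewrite mulrDr coindD. Qed.
HB.instance Definition _ := GRing.Zmodule_isLmodule.Build R coind
  coind_scaleA coind_scale1 coind_scaleDr coind_scaleDl.

(** Evaluation at 1 turns R-linear maps into Hom_Z(R, D) into additive maps into D; an additive
    extension g returns as b -> (r -> g (r *: b)). *)
Lemma coind_injective : injective_module D -> injective_module (coind : lmodType R).
Proof.
move=> Di A B i f ii.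
have iZ : linear (i : zmodule A -> zmodule B) by apply: int_linear => x y; exact: linearD.
have fZ : linear ((fun a => coind_val (f a) 1) : zmodule A -> zmodule D).
  by apply: int_linear => x y; rewrite linearD.
have fZ' : linear ((fun a => coind_val (f a) 1) : zmodule A -> D).
  by move=> a x y; rewrite -[X in X *: coind_val _ _]intz scaler_int; exact: fZ.
have [g gE] := Di _ _ (mklin iZ) (mklin fZ') ii.
have gD b : {morph (fun r : R => g (r *: b)) : x y / x + y}.
  by move=> x y; rewrite scalerDl; exact: (linearD g).
have gl : linear (fun b => Coind (gD b)).
  move=> a x y; apply: coind_eq => r /=; rewrite scalerDr scalerA.
  exact: (linearD g).
exists (mklin gl) => x; apply: coind_eq => r /=.
rewrite -[r *: i x]linearZ.
have -> : g (i (r *: x)) = coind_val (f (r *: x)) 1 by exact: gE.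
by rewrite [f _]linearZ /= mul1r.
Qed.
End Coinduced.

Section Hull.
Variable R : comNzRingType.

Lemma injective_embedding (M : lmodType R) : exists (J : lmodType R) (j : {linear M -> J}),
  injective_module J /\ injective j.
Proof.
have [D [d [di div]]] := divisible_embedding M.
have dD m : {morph (fun r : R => d (r *: m)) : x y / x + y}.
  by move=> x y; rewrite scalerDl; exact: (linearD d).
have jl : linear (fun m => Coind (dD m)).
  move=> a x y; apply: coind_eq => r /=; rewrite scalerDr scalerA.
  exact: (linearD d).
exists (coind R D : lmodType R), (mklin jl); split.
  exact/coind_injective/divisible_injective.
move=> x y /(congr1 (fun u => coind_val u 1)) /=; rewrite !scale1r; exact: di.
Qed.
End Hull.

(** * Noetherian rings and injective hulls *)

Lemma pred_zorn (T : Type) (Q : (T -> Prop) -> Prop) (D0 : T -> Prop) :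
  Q D0 ->
  (forall A : (T -> Prop) -> Prop, (exists D, A D) -> (forall D, A D -> Q D) ->
    (forall D D', A D -> A D' -> (forall x, D x -> D' x) \/ (forall x, D' x -> D x)) ->
    Q (fun x => exists2 D, A D & D x)) ->
  exists D, Q D /\ forall D', Q D' -> (forall x, D x -> D' x) -> forall x, D' x -> D x.
Proof.
move=> Q0 QU; pose S := {D | Q D}.
have [||| [D QD] Dmax] := @Zorn_preorder S (exist _ D0 Q0)
    (fun a b : S => forall x, sval a x -> sval b x).
- by [].
- by move=> a b c ab bc x /ab/bc.
- move=> A [a Aa] Ac; pose A' D := exists QD : Q D, A (exist _ D QD).
  have QA' : Q (fun x => exists2 D, A' D & D x).
    apply: QU; first by case: a Aa => D QD Aa; exists D, QD.
      by move=> D [].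
    by move=> D D' [QD AD] [QD' AD']; have := Ac _ _ AD AD'.
  exists (exist _ _ QA') => -[D QD] AD x /= Dx; exists D => //; by exists QD.
by exists D; split=> // D' QD'; apply: (Dmax (exist _ D' QD')).
Qed.

Section Families.
Variables (R : comNzRingType) (M : lmodType R).

Definition directed_family (A : (M -> Prop) -> Prop) : Prop :=
  [/\ exists D, A D, forall D, A D -> submod D
    & forall D D', A D -> A D' ->
        exists2 D'', A D'' & (forall x, D x -> D'' x) /\ (forall x, D' x -> D'' x)].

Definition family_union (A : (M -> Prop) -> Prop) : M -> Prop :=
  fun x => exists2 D, A D & D x.

Lemma directed_submod A : directed_family A -> submod (family_union A).
Proof.
move=> [[D0 A0] As Ad]; split; first by exists D0 => //; exact: submod0 (As _ A0).
move=> a x y [D AD Dx] [D' AD' Dy]; have [D'' AD'' [l l']] := Ad _ _ AD AD'.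
by exists D'' => //; apply: (As _ AD'').2; [exact: l|exact: l'].
Qed.

Lemma chain_directed (A : (M -> Prop) -> Prop) :
  (exists D, A D) -> (forall D, A D -> submod D) ->
  (forall D D', A D -> A D' -> (forall x, D x -> D' x) \/ (forall x, D' x -> D x)) ->
  directed_family A.
Proof.
move=> ne sA Ac; split=> // D D' AD AD'.
by have [l|l] := Ac _ _ AD AD'; [exists D'|exists D].
Qed.

Fixpoint span (s : seq M) (x : M) : Prop :=
  if s is a :: s' then exists r y, span s' y /\ x = r *: a + y else x = 0.

Lemma span_submod s : submod (span s).
Proof.
elim: s => [|a s IH]; first by split=> // r x y -> ->; rewrite scaler0 addr0.
split=> [|r x y [b [x' [sx ->]]] [c [y' [sy ->]]]].
  by exists 0, 0; split; [exact: submod0|rewrite scale0r addr0].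
exists (r * b + c), (r *: x' + y'); split; first exact: IH.2.
by rewrite scalerDr scalerDl -scalerA addrACA.
Qed.

Lemma span_mem s a : a \in s -> span s a.
Proof.
elim: s => // b s IH; rewrite inE => /orP[/eqP->|/IH sa].
  by exists 1, 0; rewrite scale1r addr0; split=> //; exact: submod0 (span_submod s).
by exists 0, a; rewrite scale0r add0r.
Qed.

Lemma span_min (D : M -> Prop) s : submod D -> (forall a, a \in s -> D a) ->
  forall x, span s x -> D x.
Proof.
move=> sD; elim: s => [|a s IH] h x /=; first by move=> ->; exact: submod0.
move=> [r [y [sy ->]]]; apply: sD.2; first by apply: h; rewrite mem_head.
by apply: IH => // b bs; apply: h; rewrite inE bs orbT.
Qed.

Definition fgsub (D : M -> Prop) : Prop := exists s, forall x, D x <-> span s x.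

End Families.

Section FgMaps.
Variables (R : comNzRingType) (L M : lmodType R).

(** The finitely many generators of I land in a single member. With I an ideal, this is how
    Noetherianity makes unions and sums of injective modules injective. *)
Lemma directed_fg (I : L -> Prop) (f : L -> M) A :
  fgsub I -> submod I -> (forall a x y, I x -> I y -> f (a *: x + y) = a *: f x + f y) ->
  directed_family A -> (forall x, I x -> family_union A (f x)) ->
  exists2 D, A D & forall x, I x -> D (f x).
Proof.
move=> [s sE] sI lf [ne As Ad] fA.
suff [D AD sD] : exists2 D, A D & forall a, a \in s -> D (f a).
  exists D => // x Ix.
  have sI' : submod (fun x => I x /\ D (f x)).
    split=> [|a y z [Iy Dy] [Iz Dz]].
      split; first exact: (submod0 sI).
      have -> : f 0 = 0; last exact: (submod0 (As _ AD)).
      have := lf (-1) 0 0 (submod0 sI) (submod0 sI).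
      by rewrite scaler0 addr0 scaleN1r addNr.
    by split; [exact: sI.2|rewrite lf //; exact: (As _ AD).2].
  have sub a : a \in s -> I a /\ D (f a) by move=> ais; split; [apply/sE/span_mem|exact: sD].
  by have [] := span_min sI' sub ((sE x).1 Ix).
have {sE} : forall a, a \in s -> I a by move=> a ais; apply/sE/span_mem.
elim: s => [|a s IH] sI'; first by have [D AD] := ne; exists D.
have [|D AD sD] := IH; first by move=> b bs; apply: sI'; rewrite inE bs orbT.
have [|D' AD' Da] := fA a; first by apply: sI'; rewrite mem_head.
have [D'' AD'' [l l']] := Ad _ _ AD AD'; exists D'' => // b.
by rewrite inE => /orP[/eqP->|/sD/l//]; exact: l'.
Qed.

End FgMaps.

Section Noeth.
Variable R : comNzRingType.

Definition noeth : Prop := forall I : R^o -> Prop, submod I -> fgsub I.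

Lemma ideal_spanE (s : seq R) (x : R) : ideal_span s x <-> span (s : seq R^o) x.
Proof.
elim: s x => [|a s IH] x /=.
  split=> [[c ->]|->]; first by rewrite big_ord0.
  by exists (fun=> 0); rewrite big_ord0.
split=> [[c ->]|[r [y [/IH[c ->] ->]]]].
  rewrite big_ord_recl /=; exists (c 0%N), (\sum_(i < size s) c i.+1 * s`_i).
  by split=> //; apply/IH; exists (fun i => c i.+1).
exists (fun i => if i is i'.+1 then c i' else r).
by rewrite big_ord_recl /=.
Qed.

Lemma noetherian_noeth : noetherian R -> noeth.
Proof.
(* [noetherian] speaks of proper ideals; the unit ideal is spanned by 1. *)
move=> nR I sI; have [I1|nI1] := pselect (I 1).
  exists [:: 1] => x; split=> [Ix|]; last by move=> [r [y [-> ->]]]; rewrite addr0;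
    exact: (submodZ sI).
  exists x, 0; split=> //; rewrite addr0; exact/esym/mulr1.
pose I' : {pred R} := fun x => `[< I x >].
have I'E x : x \in I' <-> I x by split=> /asboolP.
have [|s sE] := nR I'.
  split; first by apply/I'E; exact: (submod0 sI).
    by apply/negP => /I'E.
  by move=> a x y /I'E Ix /I'E Iy; apply/I'E; exact: sI.2.
by exists s => x; rewrite -I'E sE; exact: ideal_spanE.
Qed.

Hypothesis nR : noeth.

Lemma submod_fg (M : lmodType R) (s : seq M) (D : M -> Prop) :
  submod D -> (forall x, D x -> span s x) -> fgsub D.
Proof.
move=> sD; elim: s D sD => [|a s IH] D sD Ds.
  by exists [::] => x; split=> [/Ds//|->]; exact: (submod0 sD).
(* The ideal of coefficients of a in elements of D. Lifts to D of its generators form u; the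
   induction hypothesis for the part of D inside [span s] gives v. *)
pose I (r : R^o) := exists2 y, span s y & D (r *: a + y).
have sI : submod I.
  split; first by exists 0; [exact: submod0 (span_submod s)|rewrite scale0r addr0; exact: submod0].
  move=> c r r' [y sy Dy] [y' sy' Dy']; exists (c *: y + y').
    exact: (span_submod s).2.
  by rewrite scalerDl -scalerA addrACA -scalerDr; exact: sD.2.
have [t tE] := nR sI.
have [u [uD uE]] : exists u : seq M, (forall b, b \in u -> D b) /\
    forall r, span t r -> exists x y, [/\ span u x, span s y & x = r *: a + y].
  have {tE} : forall r, r \in t -> I r by move=> r rt; apply/tE/span_mem.
  elim: t => [|r t IHt] tI.
    exists [::]; split=> // r ->; exists 0, 0; split=> //; first exact: submod0 (span_submod s).
    by rewrite scale0r addr0.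
  have [|u [uD uE]] := IHt; first by move=> r' r't; apply: tI; rewrite inE r't orbT.
  have [|y sy Dy] := tI r; first by rewrite mem_head.
  exists (r *: a + y :: u); split=> [b|r' [c [r'' [tr'' ->]]]].
    by rewrite inE => /orP[/eqP->|/uD].
  have [x [y' [ux sy' xE]]] := uE r'' tr''.
  exists (c *: (r *: a + y) + x), (c *: y + y'); split.
  - by exists c, x.
  - exact: (span_submod s).2.
  by rewrite xE scalerDl -scalerA scalerDr addrACA.
have [||v vE] := IH (fun x => D x /\ span s x).
- split=> [|c x y [Dx sx] [Dy sy]]; first by split; [exact: submod0|exact: submod0 (span_submod s)].
  by split; [exact: sD.2|exact: (span_submod s).2].
- by move=> x [].
exists (u ++ v) => x; split=> [Dx|].
  have [r [y [sy xE]]] := Ds x Dx.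
  have /tE/uE[x' [y' [ux' sy' x'E]]] : I r by exists y; rewrite -?xE.
  have Dx' : D x' by apply: (span_min sD uD).
  have yE : y - y' = x - x' by rewrite xE x'E opprD addrACA subrr add0r.
  have /vE vy : D (y - y') /\ span s (y - y').
    by split; [rewrite yE; exact: (submodB sD)|exact: (submodB (span_submod s))].
  have -> : x = x' + (y - y') by rewrite yE addrC subrK.
  apply: submodD; first exact: span_submod.
    by move: x' ux' {yE x'E Dx' vy}; apply: span_min; [exact: span_submod|move=> b bu;
      apply: span_mem; rewrite mem_cat bu].
  by move: (y - y') vy {yE}; apply: span_min; [exact: span_submod|move=> b bu; apply: span_mem;
    rewrite mem_cat bu orbT].
apply: span_min => // b; rewrite mem_cat => /orP[/uD//|bv].
by have /vE[] : span v b by exact: span_mem.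
Qed.

Lemma baer_directed (M : lmodType R) (A : (M -> Prop) -> Prop) :
  directed_family A -> (forall D, A D -> baer D) -> baer (family_union A).
Proof.
move=> dA Ab I f sI fA lf.
have [D AD fD] := directed_fg (nR sI) sI lf dA fA.
have [y Dy yE] := Ab _ AD I f sI fD lf.
by exists y => //; exists D.
Qed.

End Noeth.

Section HullExists.
Variable R : comNzRingType.

Definition essential (X E : lmodType R) (i : {linear X -> E}) : Prop :=
  forall e, e != 0 -> exists r x, r *: e = i x /\ r *: e != 0.

(* E is a maximal essential extension D of X inside an injective J; with L maximal
   among the submodules meeting D trivially, J / L embeds in J over D and its image
   is again essential over X, so D is a retract of J. *)
Lemma hull_exists (X : lmodType R) : exists (E : lmodType R) (i : {linear X -> E}),
  [/\ injective i, injective_module E & essential i].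
Proof.
have [J [j [Ji ji]]] := injective_embedding X.
pose Q D := [/\ submod D, forall x, D (j x)
  & forall e, D e -> e != 0 -> exists r x, r *: e = j x /\ r *: e != 0].
have [||D [[sD jD eD] Dmax]] := @pred_zorn J Q (fun y => exists x, y = j x).
- split=> [|x|e [x ->] e0]; first exact: submod_im; first by exists x.
  by exists 1, x; rewrite scale1r.
- move=> A ne AQ Ac; have dA := chain_directed ne (fun D AD => let: And3 h _ _ := AQ D AD in h) Ac.
  split=> [|x|e [D AD De]]; first exact: (directed_submod dA).
    by have [D AD] := ne; exists D => //; have [_ h _] := AQ _ AD.
  by have [_ _ h] := AQ _ AD; exact: h.
have [||L [[sL LD] Lmax]] := @pred_zorn J (fun L => submod L /\ forall x, L x -> D x ->
  x = 0) (fun y => y = 0).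
- by split=> //; split=> // a x y -> ->; rewrite scaler0 addr0.
- move=> A ne AQ Ac; have dA := chain_directed ne (fun D AD => (AQ D AD).1) Ac.
  split; first exact: (directed_submod dA).
  by move=> x [L AL Lx]; exact: (AQ _ AL).2.
have [Y [p [ps pL]]] := quot_exists sL.
have [K [k [ki kD]]] := sub_exists sD.
have pki : injective (p \o k).
  apply: lin_inj => x /= /pL Lx; apply: (inj_lin0 ki); apply: LD => //.
  by apply/kD; exists x.
have [th thE] := Ji _ _ (p \o k) k pki.
have thD d : D d -> th (p d) = d by move=> /kD[x ->]; exact: thE.
(* Otherwise L + R y would still meet D trivially, since a nonzero d of D in it satisfies p d = r *:
   p y; maximality of L then puts y in L. *)
have meet y : p y != 0 -> exists r d, [/\ D d, d != 0 & p d = r *: p y].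
  move=> py; apply: contrapT => no; apply/negP: py; rewrite negbK; apply/eqP/pL.
  pose L' x := exists l r, L l /\ x = l + r *: y.
  apply: (Lmax L'); last by exists 0, 1; rewrite scale1r add0r; split=> //; exact: submod0.
    split.
      split=> [|a _ _ [l [r [Ll ->]]] [l' [r' [Ll' ->]]]].
        by exists 0, 0; rewrite scale0r addr0; split=> //; exact: submod0.
      exists (a *: l + l'), (a * r + r'); split; first exact: sL.2.
      by rewrite scalerDr scalerDl -scalerA addrACA.
    move=> _ [l [r [Ll ->]]] Dd; apply/eqP; apply: contrapT => /negP d0; apply: no.
    exists r, (l + r *: y); split=> //.
    by rewrite linearD linearZ (pL l).2 // add0r.
  by move=> l Ll; exists l, 0; rewrite scale0r addr0.
have thi : injective th.
  apply: lin_inj => z; have [y <-] := ps z => ty; apply/eqP; apply: contrapT => /negP.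
  move=> /meet[r [d [Dd /eqP d0 de]]]; apply: d0.
  by rewrite -(thD d Dd) de linearZ /= ty scaler0.
have thDD z : D (th z).
  apply: (Dmax (fun e => exists z, e = th z)); last by exists z.
    split=> [|x|_ [z' ->]]; first exact: submod_im.
      by exists (p (j x)); rewrite thD.
    have [y <-] := ps z' => ty.
    have /meet[r [d [Dd d0 de]]] : p y != 0 by apply: contraNneq ty => ->; rewrite linear0.
    have [s [x [sx s0]]] := eD d Dd d0.
    exists (s * r), x; have -> : (s * r) *: th (p y) = s *: d; last by [].
    by rewrite -scalerA; congr (_ *: _); rewrite -[RHS](thD d Dd) de linearZ.
  by move=> d Dd; exists (p d); rewrite thD.
have [y|q qE] := @lin_corestrict _ _ _ _ k (th \o p) ki.
  exact/kD/thDD.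
have [x|i iE] := @lin_corestrict _ _ _ _ k j ki; first exact/kD/jD.
exists K, i; split.
- by move=> x y e; apply: ji; rewrite -!iE e.
- apply: (injective_retract (i := k) (p := q) Ji) => x; apply: ki.
  by rewrite qE /= thD //; apply/kD; exists x.
move=> e e0; have ke0 : k e != 0 by apply: contraNneq e0 => h; apply/eqP/(inj_lin0 ki).
have [|r [x [rx r0]]] := eD (k e) _ ke0; first by apply/kD; exists e.
exists r, x; split; first by apply: ki; rewrite linearZ iE.
by apply: contraNneq r0 => h; rewrite -linearZ h linear0.
Qed.

End HullExists.

(** * Precovers by torsion-free injective modules *)

Section DirectSum.
Variables (R : comNzRingType) (L : Type) (H : L -> lmodType R).

(** [{classic L}] gives the bare type L an equality test, so that finite supports can be
    sequences. *)
Let supported (l : seq {classic L}) : dprod H -> Prop :=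
  fun u => forall a : {classic L}, u a <> 0 -> a \in l.

Let family : (dprod H -> Prop) -> Prop := fun D => exists l, D = supported l.

Fact supported_family : directed_family family.
Proof.
split; first by exists (supported [::]), [::].
  move=> _ [l ->]; split=> [a|c u v ul vl a]; first by rewrite dprod0E.
  have [u0|/eqP/ul//] := eqVneq (u a) 0; rewrite dprodDE dprodZE u0 scaler0 add0r.
  exact: vl.
move=> _ _ [l ->] [l' ->]; exists (supported (l ++ l')); first by exists (l ++ l').
by split=> u ul a /ul; rewrite mem_cat => ->; rewrite ?orbT.
Qed.

Lemma direct_sum_exists : exists (S : lmodType R) (inc : forall a, {linear H a -> S})
    (pr : forall a, {linear S -> H a}),
  [/\ forall a x, pr a (inc a x) = x,
      forall u, (forall a, pr a u = 0) -> u = 0,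
      forall (N : lmodType R) (f : forall a, {linear H a -> N}),
        exists phi : {linear S -> N}, forall a x, phi (inc a x) = f a x
    & noeth R -> (forall a, injective_module (H a)) -> injective_module S].
Proof.
have [S [i [ii iE]]] := sub_exists (directed_submod supported_family).
pose del a (x : H a) : dprod H := fun b =>
  if pselect (a = b) is left e then eq_rect a (fun c => H c : Type) x b e else 0.
have dela a x : del a x a = x.
  by rewrite /del; case: pselect => // e; rewrite (Prop_irrelevance e erefl).
have delN a b x : a <> b -> del a x b = 0 by rewrite /del; case: pselect.
have dell a : linear (del a).
  move=> c x y; apply: dfunext => b; rewrite dprodDE dprodZE.
  have [<-|ab] := pselect (a = b); first by rewrite !dela.
  by rewrite !delN // scaler0 addr0.
have [inc incE] : exists inc : forall a, {linear H a -> S}, forall a x, i (inc a x) = del a x.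
  have key a : exists f : {linear H a -> S}, forall x, i (f x) = del a x.
    have [x|f fE] := @lin_corestrict _ _ _ _ i (mklin (dell a)) ii; last by exists f.
    apply/iE; exists (supported [:: (a : {classic L})]); first by eexists.
    move=> b; rewrite mklinE inE => nb; apply/eqP; apply: contrapT => ba.
    by apply: nb; apply: delN => ab; apply: ba.
  by exists (fun a => sval (cid (key a))) => a; case: cid.
have prl a : linear (fun u : S => i u a).
  by move=> c x y; rewrite linearP dprodDE dprodZE.
exists S, inc, (fun a => mklin (prl a)); split.
- by move=> a x; rewrite mklinE incE dela.
- by move=> u u0; apply: (inj_lin0 ii); apply: dfunext => a; exact: (u0 a).
- move=> N f.
  (* The sum of the f a (u a) is the same over every duplicate-free list containing the support, so
     it defines a map on S. *)
  have sums (l l' : seq {classic L}) (u : dprod H) : uniq l -> uniq l' ->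
      supported l u -> supported l' u ->
      \sum_(a <- l) f a (u a) = \sum_(a <- l') f a (u a).
    move=> ul ul' sl sl'.
    have norm (k : seq {classic L}) : uniq k -> supported k u ->
      \sum_(a <- k) f a (u a) = \sum_(a <- [seq a <- k | u a != 0]) f a (u a).
      move=> uk sk; rewrite big_filter (bigID (fun a => u a != 0)) /=.
      rewrite [X in _ + X]big1 ?addr0 // => a; rewrite negbK => /eqP->.
      exact: linear0.
    rewrite (norm l) // (norm l') //; apply: (@perm_big _ _ _ {classic L}); apply: uniq_perm.
    - exact: filter_uniq.
    - exact: filter_uniq.
    move=> a; rewrite !mem_filter; have [//|/eqP u0] := eqVneq (u a) 0.
    by rewrite sl ?sl'.
  have key (x : S) : exists y, forall l, uniq l -> supported l (i x) ->
      y = \sum_(a <- l) f a (i x a).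
    have [_ [l ->] lx] : family_union family (i x) by apply/iE; exists x.
    have lx' : supported (undup l) (i x) by move=> a /lx; rewrite mem_undup.
    exists (\sum_(a <- undup l) f a (i x a)) => l' ul' lx''.
    by apply: sums => //; exact: undup_uniq.
  have [h hE] := choice key.
  have hl : linear h.
    move=> c x y.
    have [_ [l ->] lx] : family_union family (i x) by apply/iE; exists x.
    have [_ [l' ->] ly] : family_union family (i y) by apply/iE; exists y.
    pose k := undup (l ++ l').
    have kx : supported k (i x) by move=> a /lx; rewrite mem_undup mem_cat => ->.
    have ky : supported k (i y) by move=> a /ly; rewrite mem_undup mem_cat orbC => ->.
    have uk : uniq k by exact: undup_uniq.
    rewrite (hE x k) // (hE y k) // (hE _ k) //.
      rewrite scaler_sumr -big_split /=; apply: eq_bigr => a _.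
      by rewrite linearP dprodDE dprodZE linearP.
    move=> a; rewrite linearP dprodDE dprodZE; have [x0|/eqP/kx//] := eqVneq (i x a) 0.
    by rewrite x0 scaler0 add0r => /ky.
  exists (mklin hl) => a x; rewrite mklinE (hE _ [:: (a : {classic L})]) //.
    by rewrite big_seq1 incE dela.
  move=> b; rewrite incE inE => nb; apply/eqP; apply: contrapT => ba.
  by apply: nb; apply: delN => ab; apply: ba.
(* By finite generation the whole image f(I) is supported in one list l; the witnesses found in each
   coordinate are then cut off outside l. *)
move=> nR Hi; apply: (@baer_sub _ _ S i _ ii iE) => I f sI fA lf.
have lfD : forall a x y, I x -> I y -> f (a *: x + y) = a *: f x + f y by exact: lf.
have [_ [l ->] fl] := directed_fg (nR I sI) sI lfD supported_family fA.
have key a : exists y, forall r, I r -> f r a = r *: y.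
  have [//|b r s Ir Is|y _ yE] := baer_of_injective (Hi a) (f := fun r => f r a) sI.
    by rewrite lf.
  by exists y.
pose y0 a := sval (cid (key a)).
have y0E a r : I r -> f r a = r *: y0 a by move=> Ir; rewrite /y0; case: cid => /= ? ->.
exists (fun a => if (a : {classic L}) \in l then y0 a else 0).
  by exists (supported l); [exists l|move=> a; case: ifP].
move=> r Ir; apply: dfunext => a.
rewrite -[RHS]/(r *: (if (a : {classic L}) \in l then y0 a else 0)); case: ifP => al;
  first exact: y0E.
rewrite scaler0; apply/eqP; apply: contrapT => /negP/eqP/(fl r Ir).
by rewrite al.
Qed.

End DirectSum.

Section TorsionFree.
Variables (R : comNzRingType) (m : R -> Prop).

(* [torsfree M] is Hom(R / (m), M) = 0. *)
Definition torsfree (M : lmodType R) : Prop :=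
  forall x : M, (forall a, m a -> a *: x = 0) -> x = 0.

Lemma torsfree_sub (A B : lmodType R) (i : {linear A -> B}) :
  injective i -> torsfree B -> torsfree A.
Proof.
move=> ii tB x mx; apply: (inj_lin0 ii); apply: tB => a ma.
by rewrite -linearZ mx // linear0.
Qed.

Lemma torsfree_essential (X E : lmodType R) (i : {linear X -> E}) :
  injective i -> essential i -> torsfree X -> torsfree E.
Proof.
move=> ii ei tX e me; apply/eqP; apply: contrapT => /negP/ei[r [x [rx /eqP r0]]].
apply: r0; rewrite rx (tX x) ?linear0 // => a ma; apply: (inj_lin0 ii).
by rewrite linearZ /= -rx scalerA mulrC -scalerA me // scaler0.
Qed.

Lemma hull_torsfree (X : lmodType R) : torsfree X ->
  exists (E : lmodType R) (i : {linear X -> E}),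
  [/\ injective i, injective_module E & torsfree E].
Proof.
move=> tX; have [E [i [ii iE ei]]] := hull_exists X.
by exists E, i; split=> //; exact: (torsfree_essential ii ei tX).
Qed.

(** The condition on f is about i x rather than x because i will be R -> E(R/I), whose kernel is
    I. *)
Lemma inj_essential (X E J : lmodType R) (i : {linear X -> E}) (f : {linear E -> J}) :
  essential i -> (forall x, f (i x) = 0 -> i x = 0) -> injective f.
Proof.
move=> ei fi; apply: lin_inj => e fe; apply/eqP; apply: contrapT => /negP/ei[r [x [rx /eqP r0]]].
by apply: r0; rewrite rx; apply: fi; rewrite -rx linearZ /= fe scaler0.
Qed.

Hypothesis nR : noeth R.

(* J is the sum, over the ideals I and the maps f : E(R/I) -> N, of those E(R/I) that
   are torsion free. A lift J' -> J is built on larger and larger injective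
   submodules of J': from a complement of such a submodule one can split off the
   injective hull of a cyclic module. *)
Lemma torsfree_injective_precover (N : lmodType R) :
  exists (J : lmodType R) (phi : {linear J -> N}),
  [/\ injective_module J, torsfree J &
      forall (J' : lmodType R) (g : {linear J' -> N}), injective_module J' -> torsfree J' ->
        exists h : {linear J' -> J}, forall x, phi (h x) = g x].
Proof.
(* The hull of R/I, with R as a dummy value when I is no ideal, so that [choice] yields a function
   of all predicates I. *)
have hullE (I : R^o -> Prop) : exists Ep : {E : lmodType R & {linear R^o -> E}},
    submod I -> [/\ injective_module (projT1 Ep), forall r, projT2 Ep r = 0 <-> I r
      & essential (projT2 Ep)].
  have [sI|nI] := pselect (submod I);
    last by exists (existT _ (R^o : lmodType R) (idfun : {linear R^o -> R^o})).
  have [Y [p [ps pI]]] := quot_exists sI.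
  have [E [i [ii Ei ei]]] := hull_exists Y.
  exists (existT _ E (i \o p : {linear R^o -> E})) => _ /=; split=> //.
    move=> r; split=> [/(inj_lin0 ii)/pI//|/pI r0]; by rewrite /= r0 linear0.
  move=> e /ei[r [y [ry r0]]]; have [x xy] := ps y.
  by exists r, x; rewrite /= xy.
have [Ep EpE] := choice hullE.
pose E I := projT1 (Ep I); pose p I : {linear R^o -> E I} := projT2 (Ep I).
pose good I := [/\ submod I, torsfree (E I) & injective_module (E I)].
(* An index carries its map E(R/I) -> N, so every such map is the restriction of phi to a
   summand. *)
pose L := {I : R^o -> Prop & ({linear E I -> N} * good I)%type}.
pose H (a : L) : lmodType R := E (projT1 a).
have Hi (a : L) : injective_module (H a) by case: a => I [f []].
have Ht (a : L) : torsfree (H a) by case: a => I [f []].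
have [J [inc [pr [prK pr0 univ Ji]]]] := direct_sum_exists H.
have [phi phiE] := univ N (fun a : L => (projT2 a).1).
exists J, phi; split.
- exact: Ji.
- by move=> x mx; apply: pr0 => a; apply: (Ht a) => c mc; rewrite -linearZ /= mx // linear0.
move=> J' g J'i J't.
pose Q (t : pmap J' J) := [/\ pmap_ok t, baer t.1 & forall x, t.1 x -> phi (t.2 x) = g x].
have [|A t chA AQ tU|t [[tok tb tphi] tmax]] := @pmap_zorn _ J' J Q (fun x => x = 0, fun=> 0).
- split=> [|I f sI f0 lf|x ->]; last by rewrite !linear0.
    split; first by split=> // a x y -> ->; rewrite scaler0 addr0.
    by move=> *; rewrite scaler0 addr0.
  by exists 0 => // r /f0->; rewrite scaler0.
- split.
  + by apply: (pmap_union_ok chA _ tU) => s /AQ[].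
  + pose A' D := exists2 s, A s & D = s.1.
    have dA : directed_family A'.
      apply: chain_directed; first by case: chA => -[s As] _; exists s.1, s.
        by move=> _ [s /AQ[[ss _] _ _] ->].
      move=> _ _ [s As ->] [s' As' ->]; have [l|l] := chA.2 _ _ As As'; [left|right] => x sx.
        by have [] := l x sx.
      by have [] := l x sx.
    have -> : t.1 = family_union A'.
      apply: funext => x; apply: propext; rewrite tU.1.
      by split=> [[s As sx]|[_ [s As ->] sx]]; [exists s.1 => //; exists s|exists s].
    by apply: baer_directed => // _ [s /AQ[_ b _] ->].
  move=> x /tU.1[s As sx]; rewrite (tU.2 _ As _ sx).2.
  by have [_ _ h] := AQ _ As; exact: h.
have [st lt] := tok.
(* The domain of t is injective, hence a direct summand of J'; rho is the projection onto it. *)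
have [rho [rhoD rhoid]] : exists rho : {linear J' -> J'},
    (forall x, t.1 (rho x)) /\ forall x, t.1 x -> rho x = x.
  have [K [i [ii iE]]] := sub_exists st.
  have [q qE] := (baer_sub ii iE tb) _ _ i idfun ii.
  exists (i \o q); split=> [x|x /iE[y ->]]; first by apply/iE; exists (q x).
  by rewrite /= qE.
have tT z' : t.1 z'.
  apply: contrapT => nz'; pose z := z' - rho z'.
  have rz : rho z = 0 by rewrite linearB (rhoid (rho z')) // subrr.
  have z0 : z != 0 by apply/eqP => /eqP; rewrite subr_eq0 => /eqP e; apply: nz'; rewrite e.
  pose I (r : R^o) := r *: z = 0.
  have sI : submod I by exact: (submod_ker (mklin (scale_linear z))).
  have [Ei pI pe] := EpE I sI; rewrite -/(E I) in Ei; rewrite -/(p I) in pI pe.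
  have [Y [q [qs qI]]] := quot_exists sI.
  have [r r0|y yE] := @lin_factor _ _ _ _ q (mklin (scale_linear z)) qs.
    exact/qI.
  have [r /qI r0|w wE] := @lin_factor _ _ _ _ q (p I) qs; first exact/pI.
  have wi : injective w.
    by apply: lin_inj => v; have [r <-] := qs v; rewrite wE => /pI/qI.
  have [u uE] := J'i _ _ w y wi.
  have uz r : u (p I r) = r *: z by rewrite -wE uE yE.
  (* Subtracting rho moves the hull of R z into ker rho, so that its image meets the domain only in
     0. It is still injective there, being so on R z, and E(R/I) is torsion free because it embeds
     in J'. *)
  pose u' : {linear E I -> J'} := u \- (rho \o u).
  have u'z r : u' (p I r) = r *: z by rewrite /= uz linearZ /= rz scaler0 subr0.
  have u'i : injective u'.
    by apply: (inj_essential pe) => r; rewrite u'z => /pI.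
  have rho_u' e : rho (u' e) = 0 by rewrite /= linearB (rhoid (rho _)) // subrr.
  have gI : good I by split=> //; exact: torsfree_sub u'i J't.
  pose gu : {linear E I -> N} := g \o u'.
  pose a : L := existT _ I (gu, gI).
  have [e te|t' [t'ok tt' t'1 t'2]] := @pmap_extend _ J' J (E I) t u' (inc a) tok.
    have u'0 : u' e = 0 by rewrite -(rhoid _ te) rho_u'.
    have e0 := inj_lin0 u'i u'0.
    by rewrite e0 !linear0 -[0 in LHS](subrr 0) -scaleN1r addrC lt ?scaleN1r ?addNr //;
      exact: (submod0 st).
  have Qt' : Q t'.
    split=> //.
      (* The enlarged domain is the direct sum of the old one and a copy of E(R/I); Baer's condition
         is checked on the two components rho (f r) and f r - rho (f r). *)
      move=> I' f sI' ft' lf.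
      have f0 : f 0 = 0.
        have := lf (-1) 0 0 (submod0 sI') (submod0 sI').
        by rewrite mulr0 addr0 scaleN1r addNr.
      have [y1 ty1 y1E] : exists2 y, t.1 y & forall r, I' r -> rho (f r) = r *: y.
        apply: (tb I' (fun r => rho (f r)) sI') => // b r s Ir Is.
        by rewrite lf // linearP.
      have fu r : I' r -> exists e, f r - rho (f r) = u' e.
        move=> Ir; have /t'1[d [e [td fE]]] := ft' r Ir.
        by exists e; rewrite fE linearD rho_u' addr0 (rhoid d) // addrC addKr.
      have key r : exists e, I' r -> f r - rho (f r) = u' e.
        have [Ir|nI] := pselect (I' r); last by exists 0.
        by have [e eE] := fu r Ir; exists e.
      have [h hE] := choice key.
      have [|b r s Ir Is|y2 _ y2E] := baer_of_injective Ei (f := h) sI'.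
      - by [].
      - apply: u'i; rewrite linearP -!hE //; last exact: sI'.2.
        by rewrite lf // linearP scalerBr opprD addrACA.
      exists (y1 + u' y2); first by apply/t'1; exists y1, y2.
      by move=> r Ir; rewrite scalerDr -y1E // -linearZ -y2E // -hE // addrC subrK.
    move=> _ /t'1[d [e [td ->]]]; rewrite t'2 // (linearD phi) (linearD g) tphi //.
    by congr (_ + _); exact: (phiE a e).
  have t'z : t'.1 z.
    apply/t'1; exists 0, (p I 1); split; first exact: submod0.
    by rewrite u'z scale1r add0r.
  have tz := (tmax t' Qt' tt' z t'z).1.
  by move/eqP: z0; apply; rewrite -(rhoid z tz).
have tl : linear t.2 by move=> c x y; apply: lt.
by exists (mklin tl) => x; rewrite mklinE tphi.
Qed.

End TorsionFree.

(** * Special approximations by modules of bounded depth *)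

Section Approximations.
Variable R : comNzRingType.

Definition ext1_perp (F : lmodType R -> Prop) (N : lmodType R) : Prop :=
  forall A, F A -> ext1_vanish A N.

Definition special_preenvelope (F : lmodType R -> Prop) (M : lmodType R) : Prop :=
  exists (N C : lmodType R) (i : {linear M -> N}) (p : {linear N -> C}),
  [/\ ses i p, ext1_perp F N & F C].

Definition special_precover (F : lmodType R -> Prop) (M : lmodType R) : Prop :=
  exists (K Q : lmodType R) (i : {linear K -> Q}) (p : {linear Q -> M}),
  [/\ ses i p, ext1_perp F K & F Q].

(** Exactness of Hom(A, J) -> Hom(A, N) -> Ext^1(A, K) -> Ext^1(A, J) = 0, carried out on maps. *)
Lemma ext1_vanish_ker (A K J N : lmodType R) (i : {linear K -> J}) (p : {linear J -> N}) :
  ses i p -> injective_module J ->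
  (forall g : {linear A -> N}, exists h : {linear A -> J}, forall x, p (h x) = g x) ->
  ext1_vanish A K.
Proof.
move=> s Ji lift L B j q sj f; have [ii ei _] := s; have [ji ej qs] := sj.
have [g gE] := Ji _ _ j (i \o f) ji.
have [x|v vE] := @lin_factor _ _ _ _ q (p \o g) qs.
  by move=> /ej[y ->] /=; rewrite gE /= (ses_comp0 _ s).
have [h hE] := lift v.
have [c|w wE] := @lin_corestrict _ _ _ _ i (g \- (h \o q)) ii.
  by apply/ei; rewrite /= linearB hE vE subrr.
exists w => x; apply: ii; rewrite wE /= (ses_comp0 _ sj) linear0.
by rewrite subr0 gE.
Qed.

(* Salce's argument, with the pullback of a precover of a cosyzygy. *)
Lemma special_preenvelope_of_precover (F : lmodType R -> Prop) :
  (forall M, special_precover F M) -> forall M, special_preenvelope F M.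
Proof.
move=> pre M; have [J [j [Ji ji]]] := injective_embedding M.
have [C [c [cs cE]]] := coker_exists j.
have [K [Q [k [q [sq Kp FQ]]]]] := pre C; have [ki kE qs] := sq.
have [P [pa [pb [pE pex pinj]]]] := pullback_exists c q.
have pbs y : exists x, pb x = y.
  by have [z zE] := cs (q y); have [x [_ xE]] := pex z y zE; exists x.
have pas z : exists x, pa x = z.
  by have [y yE] := qs (c z); have [x [xE _]] := pex z y (esym yE); exists x.
have [A [a [ai aE]]] := ker_exists pb; have [B [b [bi bE]]] := ker_exists pa.
have pa0 x : pa (a x) = 0 -> x = 0.
  move=> e; apply: (inj_lin0 ai); apply: pinj => //; by apply/aE; exists x.
have pb0 x : pb (b x) = 0 -> x = 0.
  by move=> e; apply: (inj_lin0 bi); apply: pinj => //; apply/bE; exists x.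
have [m|u uE] := @lin_corestrict _ _ _ _ (pa \o a) j (lin_inj (f := pa \o a) pa0).
  have [|x [xE x0]] := pex (j m) 0; first by rewrite linear0; apply/cE; exists m.
  by have /aE[y yE] := x0; exists y; rewrite /= -yE.
have [y|v vE] := @lin_corestrict _ _ _ _ k (pb \o b) ki.
  apply/kE; rewrite /= -pE (_ : pa (b y) = 0) ?linear0 //; by apply/bE; exists y.
have sMP : ses (a \o u) pb.
  split=> // [x y e|y].
    by apply: ji; rewrite -!uE /= (ai _ _ e : u x = u y).
  split=> [/aE[z zE]|[x ->]]; last by apply/aE; exists (u x).
  have [m mE] : exists m, pa (a z) = j m.
    by apply/cE; rewrite pE (_ : pb (a z) = 0) ?linear0 //; apply/aE; exists z.
  exists m; rewrite zE /=; congr (a _); apply/eqP; rewrite -subr_eq0; apply/eqP/pa0.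
  by rewrite !linearB mE -uE /= subrr.
exists P, Q, (a \o u), pb; split=> // A' FA'.
have sBP : ses b pa by [].
apply: (ext1_vanish_ext sBP) => //; last exact: ext1_vanish_inj.
have vi : injective v by apply: lin_inj => y v0; apply: pb0; rewrite -[pb _]vE v0 linear0.
have vs y : exists x, v x = y.
  have [|x [x0 xE]] := pex 0 (k y); first by rewrite linear0 (ses_comp0 _ sq).
  by have /bE[z zE] := x0; exists z; apply: ki; rewrite vE /= -zE.
move=> L T l t sl f; have [g gE] := Kp _ FA' _ _ _ _ sl (v \o f).
have [x|h hE] := @lin_corestrict _ _ _ _ v g vi.
  by have [y <-] := vs (g x); exists y.
by exists h => x; apply: vi; rewrite hE gE.
Qed.

End Approximations.

Section DepthClasses.
Variables (R : comNzRingType) (k : fieldType) (pi : {rmorphism R -> k}).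
Hypothesis pi_surj : forall y, exists x, pi x = y.
Let kk : lmodType R := residue_module pi.
Implicit Type P : projective_resolution kk.

Definition ker_pi (a : R) : Prop := pi a = 0.

Lemma cohom0_torsfree P (M : lmodType R) : cohom0 P 0 M <-> torsfree ker_pi M.
Proof.
rewrite cohom0_0P; split=> [h x mx|tM u x].
  have ps (y : kk) : exists r : R^o, pi r = y :> k by exact: pi_surj.
  have pl : linear (fun r : R^o => pi r : kk) by move=> a r s; rewrite rmorphD rmorphM.
  have [r|v vE] := @lin_factor _ _ _ _ (mklin pl) (mklin (scale_linear x)) ps.
    by rewrite !mklinE => /mx.
  by have := vE 1; rewrite h mklinE scale1r.
apply: tM => a ma; rewrite -linearZ (_ : a *: x = 0) ?linear0 //.
by rewrite -[LHS]/(pi a * (x : k)) ma mul0r.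
Qed.

Definition depth_ge (j : nat) (M : lmodType R) : Prop :=
  forall P i, (i < j)%N -> cohom0 P i M.

Lemma depth_ge_torsfree j M : depth_ge j.+1 M -> torsfree ker_pi M.
Proof.
have [P] := projective_resolution_exists kk.
by move=> /(_ P 0 isT)/cohom0_torsfree.
Qed.

Lemma depth_ge_inj j J : injective_module J -> torsfree ker_pi J -> depth_ge j J.
Proof. by move=> Ji Jt P [|i] _; [apply/cohom0_torsfree|exact: cohom0_inj]. Qed.

Lemma depth_ge_coker j (A J C : lmodType R) (f : {linear A -> J}) (g : {linear J -> C}) :
  ses f g -> injective_module J -> torsfree ker_pi J -> depth_ge j.+1 A -> depth_ge j C.
Proof.
move=> s Ji Jt dA P i ij; apply: (cohom0_right s); last exact: dA.
exact: (@depth_ge_inj i.+1).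
Qed.

Lemma depth_ge_ker j (A B C : lmodType R) (f : {linear A -> B}) (g : {linear B -> C}) :
  ses f g -> depth_ge j.+1 B -> depth_ge j C -> depth_ge j.+1 A.
Proof.
move=> s dB dC P [|i] ij; first by apply: (cohom0_left0 s); exact: dB.
by apply: (cohom0_left s); [exact: dC|exact: dB].
Qed.

Section Cotorsion.
Hypothesis nR : noeth R.

Lemma depth_approximation d j : depth_ge d R^o -> (j <= d)%N ->
  (forall M, special_preenvelope (depth_ge j) M) /\
  (forall M, special_precover (depth_ge j) M).
Proof.
move=> dR; elim: j => [|j IH] jd.
  (* Every module is in F_0, and injective modules are orthogonal to all: an injective embedding is
     a special preenvelope, and the identity, with zero kernel, a special precover. *)
  split=> M.
    have [J [i [Ji ii]]] := injective_embedding M; have [C [c [cs cE]]] := coker_exists i.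
    by exists J, C, i, c; split=> // A _; exact: ext1_vanish_inj.
  have s0 : submod (fun x : M => x = 0) by split=> // a x y -> ->; rewrite scaler0 addr0.
  have [K [i [ii iE]]] := sub_exists s0.
  exists K, M, i, idfun; split=> //; first by split=> // z; exists z.
  move=> A _; apply: ext1_vanish_inj => B C u v _.
  have K0 (x : K) : x = 0 by apply: ii; rewrite linear0; apply/iE; exists x.
  by exists \0 => x; rewrite [LHS]K0 [RHS]K0.
suff pre M : special_precover (depth_ge j.+1) M.
  by split=> //; exact: special_preenvelope_of_precover.
have [N [C [i [p [s Np dC]]]]] := (IH (ltnW jd)).1 M; have [ii iE ps] := s.
have [J [phi [Ji Jt lift]]] := torsfree_injective_precover ker_pi nR N.
have {}lift (A : lmodType R) (g : {linear A -> N}) : depth_ge j.+1 A ->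
    exists h : {linear A -> J}, forall x, phi (h x) = g x.
  move=> dA; have [E [e [ei Ei Et]]] := hull_torsfree (depth_ge_torsfree dA).
  have [D [q [qs qE]]] := coker_exists e.
  have se : ses e q by [].
  have [u uE] := Np D (depth_ge_coker se Ei Et dA) _ _ _ _ se g.
  have [h hE] := lift E u Ei Et.
  by exists (h \o e) => x; rewrite /= hE uE.
have phis y : exists x, phi x = y.
  have [|h hE] := lift R^o (mklin (scale_linear y)).
    by move=> P a aj; apply: dR; exact: leq_trans jd.
  by exists (h 1); rewrite hE mklinE scale1r.
have [K [a [ai aE]]] := ker_exists phi.
have sK : ses a phi by [].
have [Q [q [qi qE]]] := ker_exists (p \o phi).
have sQ : ses q (p \o phi).
  split=> // z; have [y <-] := ps z; have [x <-] := phis y; by exists x.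
have [x|b bE] := @lin_corestrict _ _ _ _ q a qi.
  by apply/qE; rewrite /= (ses_comp0 _ sK) linear0.
have [x|r rE] := @lin_corestrict _ _ _ _ i (phi \o q) ii.
  by apply/iE; apply: (ses_comp0 _ sQ).
exists K, Q, b, r; split.
- split.
  + by move=> x y e; apply: ai; rewrite -!bE e.
  + move=> y; split=> [r0|[x ->]].
      have /aE[x xE] : phi (q y) = 0 by rewrite -[phi _]rE r0 linear0.
      by exists x; apply: qi; rewrite bE.
    by apply: ii; rewrite rE /= bE (ses_comp0 _ sK) linear0.
  move=> z; have [y yE] := phis (i z).
  have /qE[x xE] : (p \o phi) y = 0 by rewrite /= yE (ses_comp0 _ s).
  by exists x; apply: ii; rewrite rE /= -xE yE.
- by move=> A dA; apply: (ext1_vanish_ker sK) => // g; exact: lift.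
apply: (depth_ge_ker sQ) dC; exact: depth_ge_inj.
Qed.

End Cotorsion.

(** * Depth of R from a regular sequence *)

Section RegularSequence.

Fact scale_lin_linear (A B : lmodType R) (f : {linear A -> B}) (x : R) :
  linear (fun y => x *: f y).
Proof. by move=> a y z; rewrite linearP scalerDr !scalerA mulrC. Qed.

(* By dimension shifting along M -> J -> J / M, with J injective. *)
Lemma ker_pi_kills_ext P i (M : lmodType R) (f : {linear res_term P i -> M}) x :
  ker_pi x -> cocycle f -> coboundary (mklin (scale_lin_linear f x)).
Proof.
move=> mx; elim: i M f => [|i IH] M f fc.
  move=> y; rewrite mklinE -linearZ.
  have /res_exact0[z ->] : res_aug P (x *: y) = 0; last exact: fc.
  by rewrite linearZ -[LHS]/(pi x * (_ : k)) mx mul0r.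
have [J [j [Ji ji]]] := injective_embedding M; have [C [c [cs cE]]] := coker_exists j.
have s : ses j c by [].
have [y|g gE] := @cohom0_inj _ _ P i _ Ji (j \o f); first by rewrite /= fc linear0.
have cc : cocycle (c \o g) by move=> y /=; rewrite -gE (ses_comp0 _ s).
(* The cochain x g bounds x j f but takes values in J. By induction its image x c g bounds in C, and
   subtracting a lift of the bounding cochain brings the values into M. *)
suff [w [wE w0]] : exists w : {linear res_term P i -> J},
    (forall y, w (res_d P i y) = x *: j (f y)) /\ forall y, c (w y) = 0.
  have [y|w' w'E] := @lin_corestrict _ _ _ _ j w ji; first exact/cE.
  by exists w' => y; apply: ji; rewrite w'E wE mklinE linearZ.
have := IH _ _ cc; case: i f fc g gE cc {IH} => [|i] f fc g gE cc /=.
  move=> h; exists (mklin (scale_lin_linear g x)); split=> y; rewrite mklinE.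
    by rewrite -gE.
  by rewrite linearZ; exact: h.
move=> [h hE]; have [h' h'E] := @res_projective _ _ P _ _ _ _ h cs.
exists (mklin (scale_lin_linear g x) \- (h' \o res_d P i)); split=> y /=.
  rewrite (_ : res_d P i (res_d P i.+1 y) = 0) ?linear0 ?subr0 ?oppr0 ?addr0.
    by rewrite mklinE -gE.
  by apply/res_exact; exists y.
by rewrite linearB h'E -hE !mklinE linearZ subrr.
Qed.

(** In Ext^i(k, C) -> Ext^{i+1}(k, A) -> Ext^{i+1}(k, A) the second map is multiplication by x,
    which is zero, so vanishing on the left passes to the middle. *)
Lemma depth_ge_regular (A C : lmodType R) (x : R) (c : {linear A -> C}) e :
  ker_pi x -> (forall a : A, x *: a = 0 -> a = 0) -> (forall z, exists y, c y = z) ->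
  (forall y, c y = 0 <-> exists a, y = x *: a) -> depth_ge e C -> depth_ge e.+1 A.
Proof.
move=> mx xreg cs cE dC P.
have xl : linear (fun a : A => x *: a) by exact: (scale_lin_linear idfun x).
have s : ses (mklin xl) c by split=> //; exact: lin_inj.
case=> [|i] ie f fc; have := ker_pi_kills_ext mx fc.
  by move=> h y; apply: xreg; exact: h.
move=> [v vE]; apply: (coboundary_left s (v := v)); first exact: dC.
by move=> y; rewrite mklinE -vE.
Qed.

Lemma span_rcons (s : seq R^o) a x :
  span (rcons s a) x <-> exists r y, span s y /\ x = r *: a + y.
Proof.
elim: s x => [|b s IH] x //=.
split=> [[r [y [/IH[r' [y' [sy' ->]] ->]]]]|[r [y [[r' [y' [sy' ->]] ->]]]]].
  by exists r', (r *: b + y'); split; [exists r, y'|rewrite addrCA].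
by exists r', (r *: a + y'); split; [apply/IH; exists r, y'|rewrite addrCA].
Qed.

Lemma depth_ge_ring s : regular_sequence s -> (forall x, x \in s -> ker_pi x) ->
  depth_ge (size s) R^o.
Proof.
move=> [_ sreg] sm.
(* Q is R modulo the first i elements, and n elements remain. Presenting Q by a surjection p with
   that kernel lets R itself, with the identity, be the case i = 0. *)
suff gen n i (Q : lmodType R) (p : {linear R^o -> Q}) : (i + n)%N = size s ->
    (forall y, exists x, p x = y) -> (forall r, p r = 0 <-> span (take i s : seq R^o) r) ->
    depth_ge n Q.
  apply: (gen (size s) 0 R^o idfun) => //; first by move=> y; exists y.
  by move=> r; rewrite take0.
elim: n i Q p => [|n IH] i Q p is_ ps pE; first by [].
have ilt : (i < size s)%N by rewrite -is_ addnS ltnS leq_addr.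
have tE : take i.+1 s = rcons (take i s) s`_i by rewrite -take_nth.
have [C [q [qs qE]]] := quot_exists (span_submod (take i.+1 s : seq R^o)).
have [r|c cE] := @lin_factor _ _ _ _ p q ps.
  move=> /pE sr; apply/qE; rewrite tE; apply/span_rcons; exists 0, r.
  by rewrite scale0r add0r.
apply: (@depth_ge_regular Q C s`_i c).
- by apply: sm; exact: mem_nth.
- move=> a; have [r <-] := ps a; rewrite -linearZ => /pE sr; apply/pE/ideal_spanE.
  by apply: (sreg i ilt); apply/ideal_spanE; rewrite mulrC.
- by move=> z; have [r <-] := qs z; exists (p r).
- move=> y; have [r <-] := ps y; rewrite cE qE tE span_rcons.
  split=> [[b [y' [sy' ->]]]|[a]].
    exists (p b); rewrite linearD (pE y').2 // addr0 -linearZ; congr (p _).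
    exact: mulrC.
  have [b <-] := ps a; rewrite -linearZ => /eqP; rewrite -subr_eq0 -linearB => /eqP/pE sb.
  exists b, (r - s`_i *: b); split=> //.
  by rewrite addrC (_ : b *: (s`_i : R^o) = s`_i *: b) ?subrK //; exact: mulrC.
apply: (IH i.+1 C q) => //; by rewrite addSnnS.
Qed.

End RegularSequence.
End DepthClasses.


(** * Direct limits *)

Section Independence.
Variable R : comNzRingType.

(** Embedding M in an injective module lowers the degree, down to 1 or 0, where vanishing is a
    statement about N and M alone. *)
Lemma cohom0_indep (N : lmodType R) (P P' : projective_resolution N) i (M : lmodType R) :
  cohom0 P i M -> cohom0 P' i M.
Proof.
case: i => [|i]; first by rewrite !cohom0_0P.
elim: i M => [|i IH] M; first by rewrite !cohom0_1P.
move=> h; have [J [j [Ji ji]]] := injective_embedding M; have [C [c [cs cE]]] := coker_exists j.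
have s : ses j c by [].
apply: (cohom0_left s); last exact: cohom0_inj.
by apply: IH; apply: (cohom0_right s) h; exact: cohom0_inj.
Qed.

Lemma Ext_eq0_cohom0 (N : lmodType R) (P : projective_resolution N) i (M : lmodType R) :
  cohom0 P i M -> Ext_eq0 i N M.
Proof. by move=> h P'; exact: cohom0_indep h. Qed.

Section Cons.
Variables (N K P0 : lmodType R) (k : {linear K -> P0}) (p : {linear P0 -> N}).
Hypotheses (s : ses k p) (prP : projective P0).
Variable P : projective_resolution K.

Let T n : lmodType R := if n is n'.+1 then res_term P n' else P0.
Let d n : {linear T n.+1 -> T n} :=
  match n with 0%N => k \o res_aug P | n'.+1 => res_d P n' end.

(** Putting P0 in front of a resolution of its syzygy shifts the complex by one on the nose, so the
    cocycles and coboundaries in question are literally the same. *)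
Lemma cons_resolution_exists : exists P' : projective_resolution N,
  forall i M, cohom0 P' i.+2 M <-> cohom0 P i.+1 M.
Proof.
have [ki kE ps] := s.
have prT n : projective (T n) by case: n => //= n; exact: res_projective.
have ex0 x : p x = 0 <-> exists y, x = d 0 y.
  split=> [/kE[y ->]|[y ->]]; last exact: (ses_comp0 _ s).
  by have [z <-] := res_aug_surj P y; exists z.
have ex n x : d n x = 0 <-> exists y, x = d n.+1 y.
  case: n x => [|n] x; last exact: res_exact.
  rewrite -res_exact0; split=> [/(inj_lin0 ki)//|e].
  by rewrite /d /= e linear0.
by exists (ProjectiveResolution prT ps ex0 ex) => i M; split=> h f fc; exact: (h f).
Qed.

End Cons.

Lemma Ext_eq0_shift (N K P0 : lmodType R) (k : {linear K -> P0}) (p : {linear P0 -> N}) i M :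
  ses k p -> projective P0 -> Ext_eq0 i.+2 N M <-> Ext_eq0 i.+1 K M.
Proof.
move=> s prP; have [P] := projective_resolution_exists K.
have [P' P'E] := cons_resolution_exists s prP P.
split=> e; first by apply: (@Ext_eq0_cohom0 _ P); apply/P'E; exact: e.
by apply: (@Ext_eq0_cohom0 _ P'); apply/P'E; exact: e.
Qed.
End Independence.

(** * Direct limits inside reduced products *)

Section DirectLimits.
Variables (R : comNzRingType) (S : directed_system R).
Local Notation I := (ds_index S).

Lemma ds_map_irr (i j : I) (h h' : ds_le i j) x : ds_map h x = ds_map h' x.
Proof. by rewrite (Prop_irrelevance h h'). Qed.

(** The value 0 at indices not above i is arbitrary; it is invisible modulo eventually zero
    families. *)
Let tau0 (i : I) (x : ds_obj i) : dprod (@ds_obj _ S) := fun j =>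
  if pselect (ds_le i j) is left ij then ds_map ij x else 0.

Fact tau0E i x j (ij : ds_le i j) : tau0 x j = ds_map ij x :> ds_obj j.
Proof. by rewrite /tau0; case: pselect => // h; exact: ds_map_irr. Qed.

Fact tau0_linear i : linear (@tau0 i).
Proof.
move=> a x y; apply: dfunext => j; rewrite dprodDE dprodZE /tau0.
by case: pselect => [h|_]; rewrite ?linearP // scaler0 addr0.
Qed.

Let evzero (u : dprod (@ds_obj _ S)) : Prop := exists i, forall j, ds_le i j -> u j = 0.

Fact evzero_submod : submod evzero.
Proof.
split=> [|a u v [i ui] [j vj]].
  by have [i] := ds_inhab S; exists i => j _; rewrite dprod0E.
have [k ik jk] := ds_directed i j; exists k => l kl.
rewrite dprodDE dprodZE ui ?vj ?scaler0 ?addr0 //.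
  exact: ds_trans jk kl.
exact: ds_trans ik kl.
Qed.

(* The direct limit embeds in the product modulo eventually zero families. *)
Lemma reduced_product_exists : exists (T : lmodType R) (tau : forall i : I, {linear ds_obj i -> T}),
  cocone tau /\ forall i x, tau i x = 0 -> exists j (ij : ds_le i j), ds_map ij x = 0.
Proof.
have [T [p [ps pE]]] := quot_exists evzero_submod.
exists T, (fun i => p \o mklin (@tau0_linear i)); split.
  move=> i j ij x /=; rewrite !mklinE; apply/eqP; rewrite -subr_eq0 -linearB; apply/eqP/pE.
  exists j => l jl; rewrite -scaleN1r dprodDE dprodZE (tau0E _ jl) (tau0E _ (ds_trans ij jl)).
  by rewrite (ds_map_comp ij jl (ds_trans ij jl)) scaleN1r subrr.
move=> i x /= /pE[l lE]; have [j ij lj] := ds_directed i l.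
by exists j, ij; have := lE j lj; rewrite mklinE (tau0E _ ij).
Qed.

(** L is known only by its universal property, which maps it to the reduced product; there the
    kernel of each structure map is visible. *)
Lemma lim_zero (L : lmodType R) (iota : forall i : I, {linear ds_obj i -> L}) i x :
  is_direct_limit iota -> iota i x = 0 -> exists j (ij : ds_le i j), ds_map ij x = 0.
Proof.
move=> [_ univ] x0; have [T [tau [tc tz]]] := reduced_product_exists.
have [[h hE] _] := univ T tau tc.
by apply: tz; rewrite -hE x0 linear0.
Qed.

Lemma cocone_im_submod (L : lmodType R) (iota : forall i : I, {linear ds_obj i -> L}) :
  cocone iota -> submod (fun z => exists i x, z = iota i x).
Proof.
move=> ic; split; first by have [i] := ds_inhab S; exists i, 0; rewrite linear0.
move=> a _ _ [i [x ->]] [j [y ->]]; have [k ik jk] := ds_directed i j.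
by exists k, (a *: ds_map ik x + ds_map jk y); rewrite linearP !ic.
Qed.

(** The projection of L modulo the union of the images agrees with 0 on every stage, hence is 0 by
    uniqueness. *)
Lemma lim_surj (L : lmodType R) (iota : forall i : I, {linear ds_obj i -> L}) z :
  is_direct_limit iota -> exists i x, z = iota i x.
Proof.
move=> [ic univ]; have [Y [q [qs qE]]] := quot_exists (cocone_im_submod ic).
have c0 : cocone (fun i : I => (\0 : {linear ds_obj i -> Y})) by [].
have [_ uniq] := univ Y _ c0.
apply/qE; rewrite (uniq q (\0 : {linear L -> Y})) // => i x /=.
by apply/qE; exists i, x.
Qed.

Lemma direct_limit_exists : exists (L : lmodType R) (iota : forall i : I, {linear ds_obj i -> L}),
  is_direct_limit iota.
Proof.
have [T [tau [tc tz]]] := reduced_product_exists.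
have [L [k [ki kE]]] := sub_exists (cocone_im_submod tc).
have key i : exists f : {linear ds_obj i -> L}, forall x, k (f x) = tau i x.
  by apply: lin_corestrict => // x; apply/kE; exists i, x.
pose iota i := sval (cid (key i)).
have iotaE i x : k (iota i x) = tau i x by rewrite /iota; case: cid.
have iotas z : exists i x, z = iota i x.
  have [i [x xE]] : exists i x, k z = tau i x by apply/kE; exists z.
  by exists i, x; apply: ki; rewrite iotaE.
have ic : cocone iota by move=> i j ij x; apply: ki; rewrite !iotaE tc.
exists L, iota; split=> // T' tau' tc'; split; last first.
  by move=> h h' hE h'E z; have [i [x ->]] := iotas z; rewrite hE h'E.
have tz' i x : iota i x = 0 -> tau' i x = 0.
  move=> e; have [|j [ij e']] := tz i x; first by rewrite -iotaE e linear0.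
  by rewrite -(tc' i j ij) e' linear0.
have key' z : exists y, forall i x, z = iota i x -> y = tau' i x.
  have [i [x ->]] := iotas z; exists (tau' i x) => j y.
  have [l il jl] := ds_directed i j; rewrite -(ic i l il) -(ic j l jl) => /eqP.
  rewrite -subr_eq0 -linearB => /eqP/tz'/eqP; rewrite linearB subr_eq0 => /eqP.
  by rewrite !tc'.
have [h hE] := choice key'.
have hl : linear h.
  move=> a z w; have [i [x ->]] := iotas z; have [j [y ->]] := iotas w.
  have [l il jl] := ds_directed i j; rewrite -(ic i l il) -(ic j l jl).
  by rewrite -linearP !(hE _ l _ erefl) linearP.
by exists (mklin hl) => i x; rewrite mklinE (hE _ i x).
Qed.

End DirectLimits.

(** * Vanishing of Ext from finitely generated modules under direct limits *)

Section FinitelyPresented.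
Variable R : comNzRingType.
Hypothesis nR : noeth R.

Lemma lin_freegE (K : choiceType) (M : lmodType R) (h : {linear {freeg K / R} -> M}) D :
  h D = \sum_(x <- dom D) coeff x D *: h << x >>.
Proof.
rewrite -[D in LHS]freeg_sumE linear_sum; apply: eq_bigr => x _.
rewrite -linearZ /=; congr (h _); apply/eqP/freeg_eqP => y.
by rewrite coeffZ !coeffU mul1r.
Qed.

Lemma freeg_span n (D : {freeg 'I_n / R}) : span [seq << a >> | a <- enum 'I_n] D.
Proof.
have sS := span_submod [seq (<< a >> : {freeg 'I_n / R}) | a <- enum 'I_n].
rewrite -[D](freeg_sumE); elim/big_ind: _ => [|x y|a _]; first exact: submod0.
  exact: submodD.
have -> : << coeff a D *g a >> = coeff a D *: << a >> :> {freeg 'I_n / R}.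
  by apply/eqP/freeg_eqP => y; rewrite coeffZ !coeffU mul1r.
by apply: submodZ => //; apply/span_mem/map_f; rewrite mem_enum.
Qed.

Definition fgmod (N : lmodType R) : Prop := exists s, forall x : N, span s x.

Lemma fgmod_cover (N : lmodType R) : fgmod N ->
  exists n (s : n.-tuple N) (p : {linear {freeg 'I_n / R} -> N}),
  (forall a, p << a >> = tnth s a) /\ forall y, exists x, p x = y.
Proof.
move=> [s sE]; exists (size s), (in_tuple s), (fglift (tnth (in_tuple s))).
have pE a : fglift (tnth (in_tuple s)) (<< a >> : {freeg _ / R}) = tnth (in_tuple s) a.
  by rewrite liftU scale1r.
split=> // y.
have [|x ->] := span_min (submod_im (fglift (tnth (in_tuple s)) : {linear {freeg 'I_(size s) / R} -> N})) _ (sE y).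
  by move=> a /(tnthP (in_tuple s))[i ->]; exists << i >>; rewrite -pE.
by exists x.
Qed.

Lemma fgmod_ker n (N K : lmodType R) (p : {linear {freeg 'I_n / R} -> N})
    (k : {linear K -> {freeg 'I_n / R}}) :
  injective k -> (forall x, p x = 0 <-> exists y, x = k y) -> fgmod K.
Proof.
move=> ki kE; have [s sE] := submod_fg nR (submod_ker p) (fun x _ => freeg_span x).
have [t tE] : exists t, s = map k t.
  have {sE} : forall a, a \in s -> exists y, a = k y.
    by move=> a ais; apply/kE/sE/span_mem.
  elim: s => [|a s IH] h; first by exists [::].
  have [|t ->] := IH; first by move=> b bs; apply: h; rewrite inE bs orbT.
  by have [|y ->] := h a; [rewrite mem_head|exists (y :: t)].
exists t => x.
have /sE sx : p (k x) = 0 by apply/kE; exists x.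
have sub a : a \in s -> exists2 y, span t y & a = k y.
  by rewrite tE => /mapP[y ty ->]; exists y => //; exact: span_mem.
have [y sy xy] := span_min (submod_imP k (span_submod t)) sub sx.
by rewrite (ki _ _ xy).
Qed.

Variables (S : directed_system R) (L : lmodType R).
Variable iota : forall i : ds_index S, {linear ds_obj i -> L}.
Hypothesis lim : is_direct_limit iota.

Lemma lim_lift_seq (s : seq L) : exists i, forall a, a \in s -> exists y, iota i y = a.
Proof.
have ic := lim.1; elim: s => [|a s [i iE]]; first by have [i] := ds_inhab S; exists i.
have [j [x ->]] := lim_surj a lim; have [l il jl] := ds_directed i j.
exists l => b; rewrite inE => /orP[/eqP->|/iE[y <-]].
  by exists (ds_map jl x); rewrite ic.
by exists (ds_map il y); rewrite ic.
Qed.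

Lemma lim_zero_seq i (s : seq (ds_obj i)) : (forall a, a \in s -> iota i a = 0) ->
  exists j (ij : ds_le i j), forall a, a \in s -> ds_map ij a = 0.
Proof.
elim: s => [|a s IH] h; first by exists i, (ds_refl i).
have [|j [ij jE]] := IH; first by move=> b bs; apply: h; rewrite inE bs orbT.
have [|j' [ij' j'E]] := lim_zero lim (x := a) (i := i); first by apply: h; rewrite mem_head.
have [l jl j'l] := ds_directed j j'; have il := ds_trans ij jl.
exists l, il => b; rewrite inE => /orP[/eqP->|bs].
  by rewrite -(ds_map_comp ij' j'l il) j'E linear0.
by rewrite -(ds_map_comp ij jl il) jE // linear0.
Qed.

(** The images of the finitely many generators come from one stage, and the finitely many relations,
    available by Noetherianity, hold at a later one. *)
Lemma lim_lift (X : lmodType R) (f : {linear X -> L}) : fgmod X ->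
  exists i (g : {linear X -> ds_obj i}), forall x, iota i (g x) = f x.
Proof.
move=> fX; have [n [s [q [qE qs]]]] := fgmod_cover fX.
have [i iE] := lim_lift_seq [seq f x | x <- s].
have key a : exists y, iota i y = f (tnth s a).
  by apply: iE; apply: map_f; exact: mem_tnth.
have [y yE] := choice key.
pose g0 : {linear {freeg 'I_n / R} -> ds_obj i} := fglift y.
have g0E D : iota i (g0 D) = f (q D).
  rewrite -[LHS]/((iota i \o g0) D) -[RHS]/((f \o q) D) lin_freegE [RHS]lin_freegE.
  apply: eq_bigr => a _; congr (_ *: _) => /=.
  by rewrite qE -yE /g0 /= liftU scale1r.
have [K [k [ki kE]]] := ker_exists q.
have [u uE] := fgmod_ker ki kE.
have [|j [ij jE]] := @lim_zero_seq i [seq g0 (k x) | x <- u].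
  move=> _ /mapP[x _ ->]; rewrite g0E (_ : q (k x) = 0) ?linear0 //.
  by apply/kE; exists x.
have [x|g gE] := @lin_factor _ _ _ _ q (ds_map ij \o g0) qs.
  move=> /kE[z ->].
  apply: (span_min (submod_ker (ds_map ij \o g0 \o k)) _ (uE z)) => a au /=.
  by apply: jE; exact: map_f.
exists j, g => x; have [z <-] := qs x.
by rewrite gE /= (lim.1 i j ij) g0E.
Qed.

(** In degree 1 a map from the syzygy to L factors through some stage and extends there. Higher
    degrees shift to the syzygy, which is again finitely generated. *)
Lemma Ext_eq0_lim n (N : lmodType R) : fgmod N ->
  (forall i : ds_index S, Ext_eq0 n N (ds_obj i)) -> Ext_eq0 n N L.
Proof.
have zero0 (M : lmodType R) (X : lmodType R) :
    Ext_eq0 0 X M <-> forall (u : {linear X -> M}) x, u x = 0.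
  split=> [h|h P]; last by apply/cohom0_0P.
  by have [P] := projective_resolution_exists X; apply/(cohom0_0P P)/(h P).
case: n => [|n].
  move=> fN h; apply/zero0 => u x; have [i [g gE]] := lim_lift u fN.
  by rewrite -gE ((zero0 _ _).1 (h i)) linear0.
elim: n N => [|n IH] N fN h.
  have [m [s [p [_ ps]]]] := fgmod_cover fN; have [K [k [ki kE]]] := ker_exists p.
  have sk : ses k p by [].
  apply/Ext_eq0_1P/(ext1_vanish_proj (@freeg_projective R _) sk) => f.
  have [i [g gE]] := lim_lift f (fgmod_ker ki kE).
  have [g' g'E] := (Ext_eq0_1P _ _).1 (h i) _ _ _ _ sk g.
  by exists (iota i \o g') => x; rewrite /= g'E gE.
have [m [s [p [_ ps]]]] := fgmod_cover fN; have [K [k [ki kE]]] := ker_exists p.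
have sk : ses k p by [].
apply/(Ext_eq0_shift n L sk (@freeg_projective R _)).
apply: IH; first exact: fgmod_ker ki kE.
by move=> i; apply/(Ext_eq0_shift n _ sk (@freeg_projective R _)).
Qed.

End FinitelyPresented.

(** * Minimality *)

Section Minimality.
Variable R : comNzRingType.
(* [T X] is the type of structures on [X] and [hom s t f] says that [f] preserves
   them: maps to M for covers, extensions of M for envelopes. *)
Variables (T : lmodType R -> Type)
  (hom : forall X Y : lmodType R, T X -> T Y -> {linear X -> Y} -> Prop).
Hypothesis hom_id : forall X (s : T X), hom s s idfun.
Hypothesis hom_comp : forall (X Y Z : lmodType R) (s : T X) (t : T Y) (u : T Z)
  (f : {linear X -> Y}) (g : {linear Y -> Z}), hom s t f -> hom t u g -> hom s u (g \o f).
Hypothesis hom_lim : forall (S : directed_system R) (t : forall i, T (ds_obj i)),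
  (forall i j (ij : @ds_le _ S i j), hom (t i) (t j) (ds_map ij)) ->
  forall (L : lmodType R) (iota : forall i : ds_index S, {linear ds_obj i -> L}),
  is_direct_limit iota -> exists u : T L, forall i, hom (t i) u (iota i).

(** For maps to M this is the precover property; for extensions of M it says that each of them maps
    to W under M. *)
Definition weakly_terminal (W : lmodType R) (w : T W) : Prop :=
  forall (X : lmodType R) (s : T X), exists f, hom s w f.

Section Endo.
Variables (W : lmodType R) (w : T W).
Hypothesis wt : weakly_terminal w.
Local Notation endo := {linear W -> W}.

Let E (f : endo) : Prop := hom w w f.

(** A chain in which every object is W. [r a a] marks a as an index, so diagrams on different parts
    of U can be compared and united. *)
Record endo_diagram (U : Type) (r : U -> U -> Prop) (f : U -> U -> endo) : Prop := EndoDiagram {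
  ed_dom : forall a b, r a b -> r a a /\ r b b;
  ed_trans : forall a b c, r a b -> r b c -> r a c;
  ed_total : forall a b, r a a -> r b b -> r a b \/ r b a;
  ed_hom : forall a b, r a b -> E (f a b);
  ed_id : forall a, r a a -> forall x, f a a x = x;
  ed_comp : forall a b c, r a b -> r b c -> forall x, f b c (f a b x) = f a c x
}.

(** The limit of the chain carries a structure and so maps back to W by weak terminality; thus W
    itself bounds the chain. *)
Lemma endo_diagram_cocone U r f : @endo_diagram U r f -> (exists a, r a a) ->
  exists g : U -> endo, (forall a, r a a -> E (g a)) /\
    forall a b, r a b -> forall x, g b (f a b x) = g a x.
Proof.
move=> ed [a0 ra0]; pose Idx := {a | r a a}; pose mk a ra : Idx := exist (fun a => r a a) a ra.
pose le (a b : Idx) := r (sval a) (sval b).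
have dir (a b : Idx) : exists2 c, le a c & le b c.
  case: a b => [a ra] [b rb]; have [rab|rba] := ed_total ed ra rb.
    by exists (mk b rb).
  by exists (mk a ra).
pose S := @DirectedSystem R Idx le (fun=> W) (fun a b _ => f (sval a) (sval b))
  (inhabits (mk a0 ra0)) (fun a => svalP a) (fun a b c => @ed_trans _ _ _ ed _ _ _) dir
  (fun a _ x => ed_id ed (svalP a) x) (fun a b c ab bc _ x => ed_comp ed ab bc x).
have [L [iota lim]] := direct_limit_exists S.
have [|u uE] := @hom_lim S (fun=> w) _ L iota lim; first by move=> a b ab; exact: (ed_hom ed ab).
have [q qE] := wt u.
exists (fun a => if pselect (r a a) is left ra then (q \o iota (mk a ra) : endo) else (idfun : endo)); split.
  by move=> a ra; case: pselect => // ra'; exact: hom_comp (uE _) qE.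
move=> a b ab x; have [ra rb] := ed_dom ed ab.
case: pselect => // rb'; case: pselect => // ra' /=; congr (q _).
exact: (lim.1 (mk a ra' : ds_index S) (mk b rb' : ds_index S) ab).
Qed.

(* A chain of endomorphisms [f a b], all bad relative to the composites [p a],
   cannot be longer than [V]; since any such chain extends, this is absurd. *)
Lemma no_bad_extension (V : Type) (kap : endo -> endo -> V) (bad : endo -> (W -> W) -> Prop) :
  (forall p, E p -> exists2 h, E h & forall p' g, E p' -> E g ->
     (forall x, p x = g (p' x)) -> bad p' (h \o g)) ->
  (forall p1 g1 p2 g2 f : endo, E g1 -> E g2 -> (forall x, p2 x = f (p1 x)) ->
     (forall x, g1 x = g2 (f x)) -> bad p1 f -> kap p1 g1 <> kap p2 g2) ->
  False.
Proof.
(* There are more indices in [V -> Prop] than values of [kap]. In a triple (r, f, p), p a is the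
   composite from the start of the chain to a. *)
move=> ext kapP; pose U := V -> Prop.
pose ok (s : (U -> U -> Prop) * (U -> U -> endo) * (U -> endo)) :=
  let: (r, f, p) := s in
  [/\ endo_diagram r f, forall a, r a a -> E (p a),
      forall a b, r a b -> forall x, p b x = f a b (p a x)
    & forall a b, r a b -> a <> b -> bad (p a) (f a b)].
pose C := {s | ok s}.
pose le (s t : C) := forall a b, (sval s).1.1 a b ->
  [/\ (sval t).1.1 a b, (sval s).1.2 a b = (sval t).1.2 a b & (sval s).2 a = (sval t).2 a].
pose idW : endo := idfun.
have ok0 : ok (fun _ _ => False, fun _ _ => idW, fun _ => idW) by [].
have [||| [[[r f] p] [ed pE pf pb]] smax] := @Zorn_preorder C (exist _ _ ok0) le.
- by move=> s a b ab.
- move=> s t u st tu a b ab; have [ab' -> ->] := st a b ab.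
  by have [ab'' -> ->] := tu a b ab'.
- move=> A [s0 As0] Ac.
  have two s t : A s -> A t -> exists2 u, A u & le s u /\ le t u.
    by move=> As At; case: (Ac s t As At) => l; [exists t|exists s] => //; split=> // a b ab.
  pose r a b := exists2 s, A s & (sval s).1.1 a b.
  have keyf (ab : U * U) : exists y, forall s, A s -> (sval s).1.1 ab.1 ab.2 ->
      y = (sval s).1.2 ab.1 ab.2.
    have [[s As sab]|no] := pselect (r ab.1 ab.2); last first.
      by exists idW => s As sab; case: no; exists s.
    exists ((sval s).1.2 ab.1 ab.2) => t At tab; have [u Au [su tu]] := two s t As At.
    by have [_ -> _] := su _ _ sab; have [_ -> _] := tu _ _ tab.
  have keyp a : exists y, forall s b, A s -> (sval s).1.1 a b -> y = (sval s).2 a.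
    have [[b [s As sab]]|no] := pselect (exists b, r a b); last first.
      by exists idW => s b As sab; case: no; exists b, s.
    exists ((sval s).2 a) => t b' At tab; have [u Au [su tu]] := two s t As At.
    by have [_ _ ->] := su _ _ sab; have [_ _ ->] := tu _ _ tab.
  have [f fE] := choice keyf; have [p pE] := choice keyp.
  have fE' s a b : A s -> (sval s).1.1 a b -> f (a, b) = (sval s).1.2 a b by apply: (fE (a, b)).
  have common a b c d : r a b -> r c d -> exists s, [/\ A s, (sval s).1.1 a b & (sval s).1.1 c d].
    move=> [s As sab] [t At tcd]; have [u Au [su tu]] := two s t As At.
    by exists u; have [? _ _] := su _ _ sab; have [? _ _] := tu _ _ tcd.
  have okr : ok (r, fun a b => f (a, b), p).
    split.
    + split.
      * move=> a b [[[[r' f'] p'] [ed' pE' pf' pb']] As /= ab].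
        by have [ra rb] := ed_dom ed' ab; split; eexists; eauto.
      * move=> a b c ab bc; have [[[[r' f'] p'] ok'] [As sab sbc]] := common _ _ _ _ ab bc.
        by exists (exist _ _ ok') => //; have [ed' _ _ _] := ok'; exact: (ed_trans ed' sab sbc).
      * move=> a b ra rb; have [[[[r' f'] p'] ok'] [As sa sb]] := common _ _ _ _ ra rb.
        have [ed' _ _ _] := ok'.
        by have [ab|ba] := ed_total ed' sa sb; [left|right]; exists (exist _ _ ok').
      * move=> a b [[[[r' f'] p'] ok'] As ab]; rewrite (fE' _ _ _ As ab).
        by have [ed' _ _ _] := ok'; exact: (ed_hom ed' ab).
      * move=> a [[[[r' f'] p'] ok'] As ra] x; rewrite (fE' _ _ _ As ra).
        by have [ed' _ _ _] := ok'; exact: (ed_id ed' ra).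
      * move=> a b c ab bc x; have [[[[r' f'] p'] ok'] [As sab sbc]] := common _ _ _ _ ab bc.
        have [ed' _ _ _] := ok'; rewrite (fE' _ _ _ As sab) (fE' _ _ _ As sbc).
        by rewrite (fE' _ _ _ As (ed_trans ed' sab sbc)); exact: (ed_comp ed' sab sbc).
    + move=> a [[[[r' f'] p'] ok'] As ra]; rewrite (pE _ _ _ As ra).
      by have [_ h _ _] := ok'; exact: h.
    + move=> a b [[[[r' f'] p'] ok'] As ab] x; have [ed' _ h _] := ok'.
      have [ra rb] := ed_dom ed' ab.
      by rewrite (fE' _ _ _ As ab) (pE _ _ _ As ra) (pE _ _ _ As rb); exact: h.
    + move=> a b [[[[r' f'] p'] ok'] As ab]; have [ed' _ _ h] := ok'.
      by rewrite (fE' _ _ _ As ab) (pE _ _ _ As ab); exact: h.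
  exists (exist _ _ okr) => s As a b ab; split=> /=; first by exists s.
    by rewrite (fE' s).
  by rewrite (pE _ s b).
(* g is a cocone to W, and P is the common value of g a \o p a, the composite along the whole chain;
   for the empty chain it is the identity. *)
have [g [gE gf [P PE Pg]]] : exists g : U -> endo, [/\ forall a, r a a -> E (g a),
    forall a b, r a b -> forall x, g b (f a b x) = g a x
    & exists2 P, E P & forall a, r a a -> forall x, P x = g a (p a x)].
  have [ne|emp] := pselect (exists a, r a a); last first.
    exists (fun=> idW); split=> [a ra|a b /(ed_dom ed)[ra _]|]; try by case: emp; exists a.
    by exists idW => [|a ra]; [exact: hom_id|case: emp; exists a].
  have [g [gE gf]] := endo_diagram_cocone ed ne; have [a0 ra0] := ne.
  exists g; split=> //; exists (g a0 \o p a0); first exact: hom_comp (pE _ ra0) (gE _ ra0).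
  move=> a ra x /=; have [ab|ab] := ed_total ed ra ra0.
    by rewrite (pf _ _ ab) gf.
  by rewrite (pf _ _ ab) gf.
have [h hE hbad] := ext P PE.
have kinj a b : r a a -> r b b -> kap (p a) (g a) = kap (p b) (g b) -> a = b.
  move=> ra rb; wlog ab : a b ra rb / r a b.
    by move=> H e; case: (ed_total ed ra rb) => l; [exact: H|apply/esym/H].
  move=> e; apply: contrapT => nab; have bd := pb _ _ ab nab.
  apply: (kapP (p a) (g a) (p b) (g b) (f a b)) ; try assumption.
  - exact: gE.
  - exact: gE.
  - by move=> x; rewrite (pf a b ab).
  - by move=> x; rewrite gf.
(* If every subset of V were an index, [kap] would inject the subsets of V into V, against
   Cantor. *)
have [u nu] : exists u, ~ r u u.
  apply: contrapT => no; have all u : r u u by apply: contrapT => nr; apply: no; exists u.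
  pose k u := kap (p u) (g u); pose D v := exists S, k S = v /\ ~ S v.
  have kk S S' : k S = k S' -> S = S' by apply: kinj.
  have nD : ~ D (k D) by move=> [S [/kk-> nS]]; apply: (nS); exists D.
  by apply: (nD); exists D.
have nru a : ~ r a u by move=> /(ed_dom ed)[].
have nur a : ~ r u a by move=> /(ed_dom ed)[].
pose r' a b := r a b \/ ((r a a \/ a = u) /\ b = u).
pose f' a b : endo := if pselect (b = u) then (if pselect (a = u) then (idfun : endo) else (h \o g a : endo)) else f a b.
pose p' a : endo := if pselect (a = u) then (h \o P : endo) else p a.
have nau a : r a a -> a <> u by move=> ra e; apply: nu; rewrite -{1}e -e.
have f'1 a b : r a b -> f' a b = f a b.
  by move=> ab; rewrite /f'; case: pselect => // e; case: (nru a); rewrite -e.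
have f'2 a : r a a -> f' a u = h \o g a :> endo.
  by move=> ra; rewrite /f'; case: (pselect (u = u)) => //= e; case: (pselect (a = u)) => //= e';
    case: (nau a ra e').
have f'3 : f' u u = idfun by rewrite /f'; case: (pselect (u = u)).
have p'1 a : r a a -> p' a = p a by move=> ra; rewrite /p'; case: pselect => // e;
  case: (nau a ra e).
have p'2 : p' u = h \o P :> endo by rewrite /p'; case: pselect.
have ru : r' u u by right; split; [right|].
have ra' a : r a a -> r' a a by left.
have ok' : ok (r', f', p').
  split.
  - split.
    + move=> a b [/(ed_dom ed)[ra rb]|[[ra|->] ->]]; split; auto.
    + move=> a b c [ab|[ab ->]] [bc|[bc ->]].
      * by left; exact: (ed_trans ed _ bc).
      * by right; split=> //; left; have [] := ed_dom ed ab.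
      * by case: (nur c).
      * by right.
    + move=> a b [ra|[_ ->]] [rb|[_ ->]].
      * by have [ab|ba] := ed_total ed ra rb; [left; left|right; left].
      * by left; right; split=> //; left.
      * by right; right; split=> //; left.
      * by left.
    + move=> a b [ab|[[ra|->] ->]].
      * by rewrite f'1 //; exact: (ed_hom ed ab).
      * by rewrite f'2 //; exact: hom_comp (gE _ ra) hE.
      * by rewrite f'3; exact: hom_id.
    + move=> a [ra|[_ ->]] x; last by rewrite f'3.
      by rewrite f'1 //; exact: (ed_id ed ra).
    + move=> a b c [ab|[[ra|->] ->]] [bc|[bc ->]] x.
      * by rewrite !f'1 //; [exact: (ed_comp ed ab bc)|exact: (ed_trans ed _ bc)].
      * have [ra rb] := ed_dom ed ab.
        by rewrite (f'1 _ _ ab) !f'2 //= gf.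
      * by case: (nur c).
      * by rewrite f'3.
      * by case: (nur c).
      * by rewrite !f'3.
  - move=> a [ra|[_ ->]]; first by rewrite p'1 //; exact: (pE _ ra).
    by rewrite p'2; exact: hom_comp PE hE.
  - move=> a b [ab|[[ra|->] ->]] x.
    + have [ra rb] := ed_dom ed ab; by rewrite f'1 // !p'1 //; exact: (pf _ _ ab).
    + by rewrite f'2 // (p'1 a ra) p'2 /= (Pg a).
    + by rewrite f'3.
  - move=> a b [ab|[[ra|->] ->]] nab //.
    + have [ra rb] := ed_dom ed ab; by rewrite f'1 // p'1 //; exact: (pb _ _ ab).
    + by rewrite f'2 // p'1 //; apply: hbad (pE _ ra) (gE _ ra) (Pg _ ra).
have [] := smax (exist _ _ ok') _ u u ru.
  by move=> a b /= ab; split=> /=; [left|rewrite f'1|rewrite p'1 //; have [] := ed_dom ed ab].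
by move=> /nu.
Qed.

(** Otherwise every endomorphism could be followed by one enlarging its kernel. Along such a chain
    the kernels of the p a grow strictly, so they take the role of [kap]. *)
Lemma stable_kernel : exists2 f, E f & forall g, E g -> forall x, g (f x) = 0 -> f x = 0.
Proof.
apply: contrapT => no.
apply: (@no_bad_extension (W -> Prop) (fun p _ x => p x = 0)
  (fun p f => exists x, f (p x) = 0 /\ p x <> 0)).
- move=> p Ep; apply: contrapT => no'; apply: no; exists p => // g Eg x gp.
  apply: contrapT => px; apply: no'; exists g => // p' g' Ep' Eg' pE.
  exists x; split; first by rewrite /= -pE.
  by move=> p'x; apply: px; rewrite pE p'x linear0.
- move=> p1 g1 p2 g2 f _ _ p2E _ [x [fx px]] e; apply: px.
  by move/(congr1 (fun P : W -> Prop => P x)): e; rewrite p2E fx => ->.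
Qed.

(** If f is not onto, chains can be prolonged by f; since the endomorphisms are injective, the
    images of the maps g a then grow strictly, so they take the role of [kap]. *)
Lemma endo_bijective : (forall f, E f -> injective f) -> forall f, E f -> bijective f.
Proof.
move=> inj f Ef; have fs y : exists x, f x = y.
  apply: contrapT => no.
  apply: (@no_bad_extension (W -> Prop) (fun _ g y => exists x, y = g x)
    (fun _ f => exists y, forall x, f x <> y)).
  - move=> p Ep; exists f => // p' g _ _ _; exists y => x /= fx.
    by apply: no; exists (g x).
  - move=> p1 g1 p2 g2 f' Eg1 Eg2 _ gE [z fz] e.
    have [x zx] : exists x, g2 z = g1 x.
      by move/(congr1 (fun P : W -> Prop => P (g2 z))): e => ->; exists z.
    by apply: (fz x); apply: (inj _ Eg2); rewrite zx gE.
have [g gK] := choice fs.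
by exists g => // x; apply: (inj _ Ef); rewrite gK.
Qed.

Fixpoint lin_iter (f : endo) n : endo := if n is n'.+1 then f \o lin_iter f n' else idfun.

Lemma lin_iterD f m n x : lin_iter f n (lin_iter f m x) = lin_iter f (n + m) x.
Proof. by elim: n => //= n ->. Qed.

(* X is the direct limit of W -> W -> ... along the map of [stable_kernel]. *)
Lemma injective_endos_exists : exists (X : lmodType R) (t : T X), weakly_terminal t /\
  forall f : {linear X -> X}, hom t t f -> injective f.
Proof.
have [f Ef fstab] := stable_kernel.
pose le (m n : nat) : Prop := (m <= n)%N.
have dir (m n : nat) : exists2 l, le m l & le n l.
  by exists (maxn m n); [exact: leq_maxl|exact: leq_maxr].
have mid (n : nat) (nn : le n n) (x : W) : lin_iter f (n - n) x = x by rewrite subnn.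
have mcomp (m n l : nat) (mn : le m n) (nl : le n l) (ml : le m l) (x : W) :
    lin_iter f (l - n) (lin_iter f (n - m) x) = lin_iter f (l - m) x.
  by rewrite lin_iterD addnBA // subnK.
pose S := @DirectedSystem R nat le (fun=> W) (fun m n _ => lin_iter f (n - m))
  (inhabits 0%N) leqnn (fun a b c ab bc => leq_trans ab bc) dir mid mcomp.
have [X [iota lim]] := direct_limit_exists S.
have iterE n : E (lin_iter f n).
  elim: n => [|n IH]; first exact: hom_id.
  exact: hom_comp IH Ef.
have [|t tE] := @hom_lim S (fun=> w) _ X iota lim; first by move=> m n mn; exact: iterE.
exists X, t; split=> [Y s|g gE].
  by have [q qE] := wt s; exists (iota 0%N \o q); exact: hom_comp qE (tE 0%N).
apply: lin_inj => x gx; have [n [y xE]] := lim_surj x lim.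
have [q qE] := wt t.
(* One stage further up, x is the image of f y; then q \o g \o iota n.+1 kills f y, and stability of
   ker f gives f y = 0. *)
have succ : iota n.+1 (f y) = x.
  have nn : le n n.+1 by exact: leqnSn.
  have := lim.1 (n : ds_index S) (n.+1 : ds_index S) nn y.
  by rewrite /= subSnn /= => ->.
rewrite -succ (fstab (q \o (g \o iota n.+1)) _ y) ?linear0 //.
  exact: hom_comp (hom_comp (tE n.+1) gE) qE.
by rewrite /= succ gx linear0.
Qed.

End Endo.

(* Enochs' theorem, for both covers and envelopes. *)
Lemma minimal_weakly_terminal (W : lmodType R) (w : T W) : weakly_terminal w ->
  exists (X : lmodType R) (t : T X), weakly_terminal t /\
  forall f : {linear X -> X}, hom t t f -> bijective f.
Proof.
move=> wt; have [X [t [tt inj]]] := injective_endos_exists wt.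
by exists X, t; split=> //; exact: endo_bijective.
Qed.

End Minimality.

(** * Covers and envelopes *)

Section CoversEnvelopes.
Variables (R : comNzRingType) (F : lmodType R -> Prop).
Hypothesis Flim : closed_direct_limits F.

Lemma covering_of_special_precover : (forall M, special_precover F M) -> covering F.
Proof.
move=> pre M; pose T (X : lmodType R) := {phi : {linear X -> M} | F X}.
pose hom (X Y : lmodType R) (s : T X) (t : T Y) (f : {linear X -> Y}) :=
  forall x, sval t (f x) = sval s x.
have hid (X : lmodType R) (s : T X) : hom _ _ s s idfun by [].
have hcomp (X Y Z : lmodType R) (s : T X) (t : T Y) (u : T Z)
  (f : {linear X -> Y}) (g : {linear Y -> Z}) :
  hom _ _ s t f -> hom _ _ t u g -> hom _ _ s u (g \o f).
  by move=> hf hg x /=; rewrite hg hf.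
have hlim (S : directed_system R) (t : forall i, T (ds_obj i)) :
  (forall i j (ij : @ds_le _ S i j), hom _ _ (t i) (t j) (ds_map ij)) ->
  forall (L : lmodType R) (iota : forall i : ds_index S, {linear ds_obj i -> L}),
  is_direct_limit iota -> exists u : T L, forall i, hom _ _ (t i) u (iota i).
  move=> tc L iota lim.
  have FL : F L by apply: (Flim lim) => i; exact: svalP (t i).
  have [[h hE] _] := lim.2 M (fun i => sval (t i)) tc.
  by exists (exist _ h FL) => i x; exact: hE.
have [K [Q [i [p [s Kp FQ]]]]] := pre M.
have wt : weakly_terminal hom (exist _ p FQ : T Q).
  by move=> X [phi FX]; exact: (ext1_vanish_lift phi s (Kp _ FX)).
have [X [[phi FX] [tt bij]]] := minimal_weakly_terminal hid hcomp hlim wt.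
exists X, phi; split=> // C' psi FC'.
by have [h hE] := tt C' (exist _ psi FC'); exists h.
Qed.

Section Extensions.
Variable M : lmodType R.

Definition ext_by_F (X : lmodType R) (g : {linear M -> X}) : Prop :=
  injective g /\ exists2 Cc : {C : lmodType R & {linear X -> C}},
    ses g (projT2 Cc) & F (projT1 Cc).

(** Direct limits are exact: u is injective by [lim_zero], and its cokernel is the limit of the
    cokernels of the t i, hence in F. *)
Lemma ext_by_F_lim (S : directed_system R)
    (t : forall i : ds_index S, {linear M -> ds_obj i})
    (L : lmodType R) (iota : forall i : ds_index S, {linear ds_obj i -> L}) :
  (forall i, ext_by_F (t i)) ->
  (forall i j (ij : @ds_le _ S i j) x, ds_map ij (t i x) = t j x) ->
  is_direct_limit iota ->
  exists2 u : {linear M -> L}, ext_by_F u & forall i x, iota i (t i x) = u x.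
Proof.
move=> tF tc lim; have ic := lim.1; have [i0] := ds_inhab S.
pose u : {linear M -> L} := iota i0 \o t i0.
have uE i x : iota i (t i x) = u x.
  have [l il i0l] := ds_directed i i0.
  by rewrite -(ic i l il) tc /= -(ic i0 l i0l) tc.
have ui : injective u.
  apply: lin_inj => x /= /(lim_zero lim)[j [ij]]; rewrite tc => tj0.
  by apply: (inj_lin0 (tF j).1).
have [C [c [cs cE]]] := coker_exists u.
have su : ses u c by [].
exists u => //; split=> //; exists (existT _ C (c : {linear L -> C})) => //=.
pose Dd i := sval (cid2 (tF i).2).
pose D i := projT1 (Dd i); pose d i : {linear ds_obj i -> D i} := projT2 (Dd i).
have sd i : ses (t i) (d i) by rewrite /d /D /Dd; case: cid2.
have FD i : F (D i) by rewrite /D /Dd; case: cid2.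
have ds i y : exists x, d i x = y by case: (sd i).
have dE i x : d i x = 0 <-> exists y, x = t i y by case: (sd i).
have mkey i j (ij : ds_le i j) : exists f : {linear D i -> D j},
    forall x, f (d i x) = d j (ds_map ij x).
  have [x|f fE] := @lin_factor _ _ _ _ (d i) (d j \o ds_map ij) (ds i); last by exists f.
  by move=> /dE[y ->] /=; apply/dE; exists y; rewrite tc.
pose f i j (ij : ds_le i j) := sval (cid (mkey i j ij)).
have fE i j (ij : ds_le i j) x : f i j ij (d i x) = d j (ds_map ij x).
  by rewrite /f; case: cid.
have f1 i (ii : ds_le i i) x : f i i ii x = x.
  by have [y <-] := ds i x; rewrite fE ds_map_id.
have f2 i j k (ij : ds_le i j) (jk : ds_le j k) (ik : ds_le i k) x :
    f j k jk (f i j ij x) = f i k ik x.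
  by have [y <-] := ds i x; rewrite !fE (ds_map_comp ij jk ik).
pose S' := @DirectedSystem R (ds_index S) (@ds_le _ S) D f (ds_inhab S) (@ds_refl _ S)
  (@ds_trans _ S) (@ds_directed _ S) f1 f2.
have ckey i : exists k : {linear D i -> C}, forall x, k (d i x) = c (iota i x).
  have [x|k kE] := @lin_factor _ _ _ _ (d i) (c \o iota i) (ds i); last by exists k.
  by move=> /dE[y ->] /=; rewrite uE (ses_comp0 _ su).
pose iota' (i : ds_index S') : {linear ds_obj i -> C} := sval (cid (ckey i)).
have iota'E i x : iota' i (d i x) = c (iota i x) by rewrite /iota'; case: cid.
apply: (Flim (S := S') (iota := iota')) => //; split.
  move=> i j ij z; have [x <-] := ds i z.
  by rewrite -[ds_map ij _]/(f i j ij (d i x)) fE !iota'E ic.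
move=> T' tau' tc'; split; last first.
  move=> h h' hE h'E z; have [x <-] := cs z.
  have [i [y ->]] := lim_surj x lim; rewrite -iota'E.
  by rewrite (hE i) (h'E i).
have [|[h hE] _] := lim.2 T' (fun i => tau' i \o d i).
  by move=> i j ij x /=; rewrite -fE; exact: (tc' i j ij).
have [x|h' h'E] := @lin_factor _ _ _ _ c h cs.
  by move=> /cE[y ->]; rewrite -(uE i0) hE /= (ses_comp0 _ (sd i0)) linear0.
exists h' => i z; have [x <-] := ds i z.
by rewrite iota'E h'E hE.
Qed.

End Extensions.

(** The minimality argument runs over extensions of M by modules of F, which pass to direct limits
    because F does; modules of [right_perp F] are not assumed to. A special preenvelope is weakly
    terminal among these extensions. *)
Lemma enveloping_of_special_preenvelope :
  (forall M, special_preenvelope F M) -> enveloping (right_perp F).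
Proof.
move=> pre M; pose T (X : lmodType R) := {g : {linear M -> X} | ext_by_F g}.
pose hom (X Y : lmodType R) (s : T X) (t : T Y) (f : {linear X -> Y}) :=
  forall x, f (sval s x) = sval t x.
have hid (X : lmodType R) (s : T X) : hom _ _ s s idfun by [].
have hcomp (X Y Z : lmodType R) (s : T X) (t : T Y) (u : T Z)
  (f : {linear X -> Y}) (g : {linear Y -> Z}) :
  hom _ _ s t f -> hom _ _ t u g -> hom _ _ s u (g \o f).
  by move=> hf hg x /=; rewrite hf hg.
have hlim (S : directed_system R) (t : forall i, T (ds_obj i)) :
  (forall i j (ij : @ds_le _ S i j), hom _ _ (t i) (t j) (ds_map ij)) ->
  forall (L : lmodType R) (iota : forall i : ds_index S, {linear ds_obj i -> L}),
  is_direct_limit iota -> exists u : T L, forall i, hom _ _ (t i) u (iota i).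
  move=> tc L iota lim.
  have [u uF uE] := ext_by_F_lim (fun i => svalP (t i)) tc lim.
  by exists (exist _ u uF) => i x; exact: uE.
have [N [C [i [p [s Np FC]]]]] := pre M.
have iF : ext_by_F i.
  by split; [case: s|exists (existT _ C (p : {linear N -> C}))].
have wt : weakly_terminal hom (exist _ i iF : T N).
  by move=> X [g [gi [[D d] /= sd FD]]]; exact: (Np _ FD _ _ _ _ sd i).
have [X [[phi phiF] [tt bij]]] := minimal_weakly_terminal hid hcomp hlim wt.
have [phi_inj [[D d] /= sd FD]] := phiF.
exists X, phi; split.
- (* X is a retract of N, because the endomorphism u \o v of X is bijective. *)
  have [v vE] := wt X (exist _ phi phiF); have [u uE] := tt N (exist _ i iF).
  have uv : hom _ _ (exist _ phi phiF) (exist _ phi phiF) (u \o v) := hcomp _ _ _ _ _ _ _ _ vE uE.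
  have [w wK Kw] := bij _ uv.
  move=> A FA; apply/Ext_eq0_1P => K B a b sab f.
  have [y|f1 f1E] := @lin_corestrict _ _ _ _ (u \o v) f (can_inj wK).
    by exists (w (f y)); rewrite Kw.
  have [g gE] := Np _ FA _ _ _ _ sab (v \o f1).
  by exists (u \o g) => x; rewrite -f1E /= gE.
- by move=> E' psi E'F; exact: ((Ext_eq0_1P _ _).1 (E'F _ FD) _ _ _ _ sd psi).
- by move=> alpha; exact: bij.
Qed.

(** A special precover of a module in the left orthogonal splits, because its kernel lies in the
    right one; so the module is a summand of one in F. *)
Lemma cotorsion_pair_of_special_precover :
  (forall M, special_precover F M) ->
  (forall (M Q : lmodType R) (i : {linear M -> Q}) (p : {linear Q -> M}), (forall x,
    p (i x) = x) -> F Q -> F M) ->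
  cotorsion_pair F (right_perp F).
Proof.
move=> pre Fsum; split=> M //; split=> [perp|FM A AF]; last exact: AF.
have [K [Q [i [p [s Kp FQ]]]]] := pre M.
have MK : ext1_vanish M K.
  by apply/Ext_eq0_1P/perp => A FA; apply/Ext_eq0_1P/Kp.
have [g gE] := ext1_vanish_lift idfun s MK.
exact: Fsum gE FQ.
Qed.

End CoversEnvelopes.

Theorem theorem5p5 (R : comNzRingType) (m : {pred R}) (k : fieldType)
    (pi : {rmorphism R -> k}) (hR : cohen_macaulay_local m pi) :
  [/\ cotorsion_pair (CohCM pi) (right_perp (CohCM pi)),
      perfect (CohCM pi) (right_perp (CohCM pi)),
      hereditary (CohCM pi)
    & closed_direct_limits (CohCM pi)].
Proof.
have [/noetherian_noeth nR [_ _ pis mE] [d dimR [[s [sreg sm sd]] _]]] := hR.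
(* [CohCM] ranges over every Krull dimension e; a chain of length e shows e <= d. *)
have CohE M : CohCM pi M <-> depth_ge pi d M.
  split=> [h P i id|h e dimR' i ie P]; first exact: (h d dimR i id P).
  apply: h; apply: leq_trans ie _.
  have [[p chain] _] := dimR'; exact: dimR.2 chain.
have dR : depth_ge pi d R^o.
  rewrite -sd; apply: depth_ge_ring sreg _ => x /sm; rewrite mE => /eqP.
  exact.
have [pre cov] := depth_approximation pis nR dR (leqnn d).
have -> : CohCM pi = depth_ge pi d by apply: funext => M; apply: propext.
have lim : closed_direct_limits (depth_ge pi d).
  move=> S L iota limL dS P i id.
  apply: (Ext_eq0_lim nR limL) => [|a P']; last exact: dS.
  (* The residue field is generated by 1, as pi is onto. *)
  exists [:: (1 : k) : residue_module pi] => y; have [r rE] := pis y.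
  by exists r, 0; split=> //; rewrite addr0 -rE; exact/esym/mulr1.
split=> //.
- apply: cotorsion_pair_of_special_precover => // M Q i p pK dQ P j jd f fc.
  have ic : cocycle (i \o f) by move=> y; rewrite /= fc linear0.
  have := dQ P j jd _ ic; case: j jd f fc ic => [|j] jd f fc ic /=.
    by move=> h x; rewrite -(pK (f x)) h linear0.
  by move=> [g gE]; exists (p \o g) => x; rewrite /= -gE pK.
- split; first exact: covering_of_special_precover.
  exact: enveloping_of_special_preenvelope.
move=> A B C f g fi fg gs dB dC.
have sfg : ses f g by [].
(* For d = 0 the class contains every module; otherwise the cokernel C needs only one degree less
   than B. *)
case: d {dimR sd dR pre cov lim CohE} dB dC => [|d] dB dC; first by [].
by apply: (depth_ge_ker sfg dB) => P i id; apply: dC; exact: leq_trans id _.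
Qed.
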